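(* Let $1\le p_0<p<\infty$, let $\Omega\subsetneq X$ be an open set, and assume that $w$ is a semilocally doubling $p_0$-Poincaré weight for $\Omega$. If a pointwise $(p,w)$-Hardy inequality holds in $\Omega$, then there exists $q\in(p_0,p)$ such that a pointwise $(q,w)$-Hardy inequality holds in $\Omega$.
   Context: Standing assumptions. $X=(X,d,\mu)$, with at least two points, is a metric measure space with a metric $d$ and a positive complete Borel regular measure $\mu$ such that, for some constant $D>1$, $0<\mu(B)<\infty$ and $\mu(2B)\le D\mu(B)$ for all balls $B=B(x,r)=\{y\in X: d(y,x)<r\}$, where $\lambda B=B(x,\lambda r)$. A curve is a rectifiable continuous map $\gamma:[a,b]\to X$, with length $\operatorname{len}(\gamma)$; it connects $x$ to $y$ (or to a set $E$) if $\gamma(a)=x$ and $\gamma(b)=y$ (respectively $\gamma(b)\in E$). $X$ is $C_{\mathrm{QC}}$-quasiconvex for a fixed $C_{\mathrm{QC}}\ge1$: all $x,y\in X$ are connected by a curve of length at most $C_{\mathrm{QC}}d(x,y)$. Open sets $\Omega$ are nonempty, $\Omega^c=X\setminus\Omega$, and $d(x,\Omega^c)=\inf_{y\in\Omega^c}d(x,y)$. Notation. For $\nu\ge 1$, $\Gamma(X)^\nu_{x,y}$ is the set of all curves connecting $x$ to $y$ with length at most $\nu d(x,y)$. $LC(X)$ is the set of lower semicontinuous real-valued functions on $X$. A Borel function $g\ge0$ is an upper gradient of $u:X\to\mathbb R$ if $|u(\gamma(a))-u(\gamma(b))|\le\int_\gamma g\,ds$ for all curves $\gamma:[a,b]\to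 X$. $\operatorname{Lip}_0(\Omega)$ is the space of Lipschitz functions $u:X\to\mathbb R$ that vanish on $\Omega^c$. Weights. A weight for $\Omega$ is a non-negative Borel function $w$ on $X$ with $\int_B w\,d\mu<\infty$ for all balls $B\subset X$ and $w(x)>0$ for almost every $x\in\Omega$; $w(E)=\int_E w\,d\mu$. For $\Omega\subsetneq X$, $w$ is semilocally doubling for $\Omega$ if for every $\kappa>0$ there is a constant $D(w,\kappa)\ge1$ such that $0<w(B(x,r))\le D(w,\kappa)\,w(B(x,r/2))<\infty$ for all $x\in\Omega$ and $0<r\le\kappa d(x,\Omega^c)$. Maximal functions. For $1\le p<\infty$, $0<\kappa<\infty$, $f$ measurable and $x\in\Omega$, $\mathcal M_{p,w,\kappa}f(x)=\sup_{0<r<\kappa d(x,\Omega^c)}\big(\frac1{w(B(x,r))}\int_{B(x,r)}|f|^pw\,d\mu\big)^{1/p}$, and $\mathcal M^R_{p,w,\kappa}f(x)$ is the same supremum restricted to $0<r<\min\{\kappa d(x,\Omega^c),R\}$ (a supremum over the empty set is $0$). $p$-Poincaré weight. For $1\le p<\infty$, a weight $w$ for $\Omega\subsetneq X$ is a $p$-Poincaré weight for $\Omega$ if there are constants $C_{\mathrm A}>0$, $\nu>C_{\mathrm{QC}}$ and $\kappa>1$ such that for each non-negative bounded $g\in LC(X)$ and all $x,y\in\Omega$ with $d(x,y)<d(x,\Omega^c)/(3\kappa)$, $$\inf_{\gamma\in\Gamma(X)^\nu_{x,y}}\int_\gamma g\,ds\le C_{\mathrm A}\,d(x,y)\big(\mathcal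 M^{\kappa d(x,y)}_{p,w,\kappa}g(x)+\mathcal M^{\kappa d(x,y)}_{p,w,\kappa}g(y)\big).$$ Pointwise Hardy inequality. For $1\le p<\infty$, a pointwise $(p,w)$-Hardy inequality holds in $\Omega$ if there are constants $C_{\mathrm H}>0$ and $\kappa>1$ such that for every $u\in\operatorname{Lip}_0(\Omega)$, every bounded upper gradient $g$ of $u$ and every $x\in\Omega$, $|u(x)|\le C_{\mathrm H}\,d(x,\Omega^c)\,\mathcal M_{p,w,\kappa}g(x)$. *)

(* Defs.v *)
From HB Require Import structures.
From mathcomp Require Import all_boot all_order all_algebra.
From mathcomp Require Import all_classical all_reals all_analysis.
From mathcomp Require Import measurable_realfun.

Set Implicit Arguments.
Unset Strict Implicit.
Unset Printing Implicit Defensive.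
Import Order.TTheory GRing.Theory Num.Theory.
Import numFieldNormedType.Exports.

Local Open Scope classical_set_scope.
Local Open Scope ring_scope.

(* The metric and the sigma-algebra are unrelated here; borel_regular below
   requires the open sets to be measurable. *)
#[short(type="metricMeasurableType")]
HB.structure Definition MetricMeasurable (R : numDomainType)
    (d : measure_display) := {X of Metric R X & Measurable d X}.

Section metric_measure_space.
Context {R : realType} {d : measure_display} {X : metricMeasurableType R d}.
Local Open Scope ereal_scope.

Definition borel : set (set X) := <<s @open X >>.

Definition borel_fun (f : X -> \bar R) :=
  forall B : set (\bar R), measurable B -> borel (f @^-1` B).

Definition borel_regular (mu : {measure set X -> \bar R}) :=
  (borel `<=` measurable) /\
  forall A : set X, measurable A ->
    exists B : set X, [/\ borel B, A `<=` B & mu B = mu A].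

Definition doubling (mu : {measure set X -> \bar R}) :=
  exists D : R, (1 < D)%R /\
    forall (x : X) (r : R), (0 < r)%R ->
      [/\ 0 < mu (ball x r), mu (ball x r) < +oo &
          mu (ball x (2 * r)) <= D%:E * mu (ball x r)].

Definition mdist_set (x : X) (E : set X) : R := inf [set mdist x y | y in E].

End metric_measure_space.

Section curves.
Context {R : realType} {d : measure_display} {X : metricMeasurableType R d}.
Implicit Types (gamma : R -> X) (a b : R).

Definition polygonal_length a b gamma (s : seq R) : R :=
  let F := gamma \o nth b (a :: s) in
  \sum_(0 <= n < size s) mdist (F n) (F n.+1).

Definition curve_length a b gamma : \bar R :=
  ereal_sup [set (polygonal_length a b gamma s)%:E | s in itv_partition a b].

Definition is_curve a b gamma :=
  [/\ a <= b, {within `[a, b], continuous gamma} &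
      (curve_length a b gamma < +oo)%E].

(* Arc-length parametrization: s is sent to gamma t, where t is the first
   parameter in [a, b] at which the length of gamma over [a, t] reaches s. *)
Definition arc_param a b gamma (s : R) : X :=
  gamma (inf [set t | a <= t <= b /\ (s%:E <= curve_length a t gamma)%E]).

Definition line_integral a b gamma (g : X -> \bar R) : \bar R :=
  (\int[lebesgue_measure]_(s in `[0%R, fine (curve_length a b gamma)])
     g (arc_param a b gamma s))%E.

(* All (a, b, gamma) such that gamma : [a, b] -> X is a curve connecting x to y
   of length at most nu * d(x, y). *)
Definition curves_between (nu : R) (x y : X) : set (R * R * (R -> X)) :=
  [set c | let: (a, b, gamma) := c in
     [/\ is_curve a b gamma, gamma a = x, gamma b = y &
         (curve_length a b gamma <= (nu * mdist x y)%:E)%E]].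

Definition upper_gradient (u : X -> R) (g : X -> \bar R) :=
  [/\ borel_fun g, (forall x, 0 <= g x)%E &
      forall a b gamma, is_curve a b gamma ->
        (`|u (gamma a) - u (gamma b)|%:E <= line_integral a b gamma g)%E].

End curves.

Definition quasiconvex {R : realType} {d : measure_display}
    (X : metricMeasurableType R d) (C : R) :=
  forall x y : X, curves_between C x y !=set0.

Section weights.
Context {R : realType} {d : measure_display} {X : metricMeasurableType R d}.
Variables (mu : {measure set X -> \bar R}) (Omega : set X).
Implicit Types (w f : X -> \bar R) (p kappa rho : R) (x y : X).
Local Open Scope ereal_scope.

Definition wmeasure w (E : set X) : \bar R := \int[mu]_(x in E) w x.

Definition weight w :=
  [/\ borel_fun w, (forall x, 0 <= w x),
      (forall x (r : R), (0 < r)%R -> wmeasure w (ball x r) < +oo) &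
      {ae mu, forall x, Omega x -> 0 < w x}].

Definition semilocally_doubling w :=
  forall kappa, (0 < kappa)%R -> exists Dw : R, (1 <= Dw)%R /\
    forall x (r : R), Omega x ->
      (0 < r <= kappa * mdist_set x (~` Omega))%R ->
      [/\ 0 < wmeasure w (ball x r),
          wmeasure w (ball x r) <= Dw%:E * wmeasure w (ball x (r / 2)) &
          Dw%:E * wmeasure w (ball x (r / 2)) < +oo].

(* The value 0 is added to the set so that an empty supremum is 0 instead
   of -oo; all the other values are nonnegative. *)
Definition sup_average p w rho f x : \bar R :=
  ereal_sup (0 |` [set ((wmeasure w (ball x r))^-1 *
                        \int[mu]_(y in ball x r) (`|f y| `^ p * w y)) `^ p^-1
                  | r in [set r : R | (0 < r < rho)%R]]).

Definition maximal p w kappa f x : \bar R :=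
  sup_average p w (kappa * mdist_set x (~` Omega))%R f x.

Definition rmaximal p w kappa rho f x : \bar R :=
  sup_average p w (Num.min (kappa * mdist_set x (~` Omega)) rho)%R f x.

Definition poincare_weight (CQC p : R) w :=
  weight w /\
  exists CA nu kappa : R, [/\ (0 < CA)%R, (CQC < nu)%R, (1 < kappa)%R &
    forall g : X -> R,
      (forall x, 0 <= g x)%R -> (exists M : R, forall x, (g x <= M)%R) ->
      lower_semicontinuous (EFin \o g) ->
      forall x y, Omega x -> Omega y ->
        (mdist x y < mdist_set x (~` Omega) / (3 * kappa))%R ->
        ereal_inf [set line_integral c.1.1 c.1.2 c.2 (EFin \o g)
                  | c in curves_between nu x y] <=
        (CA * mdist x y)%:E *
          (rmaximal p w kappa (kappa * mdist x y)%R (EFin \o g) x +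
           rmaximal p w kappa (kappa * mdist x y)%R (EFin \o g) y)].

Definition lip0 (u : X -> R) :=
  (exists L : R, forall x y, (`|u x - u y| <= L * mdist x y)%R) /\
  (forall x, (~` Omega) x -> u x = 0%R).

Definition pointwise_hardy p w :=
  exists CH kappa : R, [/\ (0 < CH)%R, (1 < kappa)%R &
    forall (u : X -> R) (g : X -> \bar R), lip0 u ->
      upper_gradient u g -> (exists M : R, forall x, g x <= M%:E) ->
      forall x, Omega x ->
        `|u x|%:E <= (CH * mdist_set x (~` Omega))%:E * maximal p w kappa g x].

End weights.

(* Main.v *)
From HB Require Import structures.
Require Import Defs.
From mathcomp Require Import all_boot all_order all_algebra.
From mathcomp Require Import all_classical all_reals all_analysis.
From mathcomp Require Import measurable_realfun.
From mathcomp Require Import ring lra.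
Set Implicit Arguments.
Unset Strict Implicit.
Unset Printing Implicit Defensive.
Import Order.TTheory GRing.Theory Num.Theory.
Import numFieldNormedType.Exports.
Local Open Scope classical_set_scope.
Local Open Scope ring_scope.

(** Why the theorem is true. Write [rho x] for the distance from [x] to the
   complement of [Omega]. A Hardy inequality is really a statement about paths.
   Given [g], the least cost [\int g ds] of a path from [x] to the complement of
   [Omega] is a Lipschitz function of [x] that vanishes off [Omega] and has [g] as
   an upper gradient, so the [(p,w)]-Hardy inequality says that this cost is at
   most a multiple of [rho x] times the maximal function of [g] at [x]
   ([hardy_joins]). Conversely, such cheap paths for all lower semicontinuous [g]
   give back the Hardy inequality by integrating the upper gradient along them
   ([hardy_of_paths]). It therefore suffices to improve the exponent for paths
   ([hardy_path_self_improvement]).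

   Let [g <= G] be lower semicontinuous, with maximal function of exponent [q] at
   most [tau] at [x]. For a large constant [M] let [E j] be the set where this
   maximal function exceeds [M^(j+1) * tau], for [j < k]. The weak type estimate,
   proved with Vitali's covering lemma, bounds the proportion of [E j] in balls
   around [x] by a multiple of [M^(-(j+1)q)]. Hence
   [h = 1 + \sum_(j < k) M^(j+1) 1_(E j)] has averages of [h^p] of order [k], as
   soon as [q] is so close to [p] that [M^(k(p-q)) <= 2]. The Hardy inequality with
   exponent [p], applied to [h], yields a path from [x] to the complement of
   [Omega], of length and [h]-cost of order [k^(1/p) * rho x]. Among the [k] levels
   one has cost of order at most [k^(1/p - 1) * rho x]: this path meets [E j] in a
   set of length at most [epsilon * rho x / M^(j+1)], with [epsilon] as small as
   desired since [1 < p] ([short_level_ex], [level_count_ex]).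

   Now replace the path by a chain of short curves given by the Poincare inequality
   between points of the path outside [E j]. Off [E j] the maximal functions of
   exponent [p0 < q] are at most [2 M^(j+1) tau], so the chain costs a constant
   times [tau * rho x]. The gaps being short, the chain can be continued up to a
   point [y] with [rho y <= rho x / (2 M^(j+1))] ([chain_to_boundary]). As [y] lies
   outside [E j], the same problem arises at [y] with [tau] replaced by
   [M^(j+1) * tau], and the product of this height with [rho y] has been halved. The
   costs sum as a geometric series, and the iteration stops when the height
   exceeds [G], where quasiconvexity provides the last path. *)

(** * Change of variables under expanding maps *)

Section expanding_change_of_variables.
Context {R : realType}.
Local Notation leb := (@lebesgue_measure R).
Local Notation mR := (measurableTypeR R).

Lemma lebesgue_measure_diam (S : set R) (e : R) : measurable S -> 0 <= e ->
  (forall s t, S s -> S t -> t - s <= e) -> (leb S <= e%:E)%E.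
Proof.
move=> mS e0 Se.
case: (pselect (S !=set0)) => [[s0 Ss0]|/nonemptyPn ->]; last by rewrite measure0.
have lbS : has_lbound S.
  by exists (s0 - e) => t St; rewrite lerBlDr -lerBlDl Se.
have SI : S `<=` `[inf S, inf S + e]%classic.
  move=> t St /=; rewrite in_itv/=; apply/andP; split; first exact: ge_inf.
  rewrite -lerBlDr; apply: lb_le_inf; first by exists s0.
  by move=> s Ss; rewrite lerBlDr -lerBlDl Se.
apply: le_trans (le_measure leb _ _ SI) _; rewrite ?inE//.
rewrite [leLHS](lebesgue_measure_itv `[inf S, inf S + e]) /= lte_fin.
by case: ifP => _; rewrite ?lee_fin// lerBlDr addrC.
Qed.

(** The preimage of an interval under an expanding map has no larger diameter;
   a cover of [A] by intervals pulls back to a cover of [T @^-1` A], and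
   Lebesgue measure is the outer measure generated by intervals. *)
Lemma expanding_preimage_le (T : mR -> mR) (A : set R) :
  measurable_fun setT (T : mR -> mR) -> (forall s t : R, `|s - t| <= `|(T s : R) - T t|) ->
  measurable A -> (leb (T @^-1` A) <= leb A)%E.
Proof.
move=> mT exT mA.
have mTA (B : set R) : measurable B -> measurable (T @^-1` B).
  by move=> mB; rewrite -[X in measurable X]setTI; exact: mT.
rewrite [leRHS]/lebesgue_measure /lebesgue_stieltjes_measure /measure_extension /mu_ext.
apply: le_ereal_inf_tmp => _ [F [mF AF] <-].
have mF' i : measurable (F i : set (measurableTypeR R)) by exact: sub_sigma_algebra.
have : (leb (T @^-1` A) <= \sum_(k <oo) leb (T @^-1` (F k)))%E.
  apply: measure_sigma_subadditive.
  - by move=> k; exact: (mTA _ (mF' k)).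
  - exact: (mTA _ mA).
  - by move=> s /AF [k _ Fk]; exists k.
move=> /le_trans; apply; apply: lee_nneseries => //.
move=> k _.
have /ocitvP[->|[[a b /= ab ->]]] : ocitv (F k) by exact: mF.
  by rewrite preimage_set0 measure0 [leRHS](wlength0 idfun).
rewrite [leRHS](wlength_itv idfun `]a, b]) /= lte_fin ab -EFinB.
apply: (@lebesgue_measure_diam (T @^-1` `]a, b]%classic) (b - a)).
- exact: (mTA _ (measurable_itv _)).
- by rewrite subr_ge0 ltW.
- move=> s t /=; rewrite !in_itv/= => /andP[asT Tsb] /andP[aTt Ttb].
  apply: le_trans (ler_norm _) _; apply: le_trans (exT _ _) _.
  by rewrite ler_norml; apply/andP; split; lra.
Qed.

(** The one change of variables used below: translations and reflections are
   expanding, and so is the inverse of an arc-length function of a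
   1-Lipschitz path. *)
Lemma ge0_integral_expanding (T : mR -> mR) (E D : set mR) (f : mR -> \bar R) :
  measurable_fun setT (T : mR -> mR) -> (forall s t : R, `|s - t| <= `|(T s : R) - T t|) ->
  measurable E -> measurable D -> (forall s, E s -> D (T s)) ->
  measurable_fun setT f -> (forall t, 0 <= f t)%E ->
  (\int[leb]_(s in E) f (T s) <= \int[leb]_(t in D) f t)%E.
Proof.
move=> mT exT mE mD ED mf f0.
have mTD : measurable (T @^-1` D) by rewrite -[X in measurable X]setTI; exact: mT.
apply: (@le_trans _ _ (\int[leb]_(s in T @^-1` D) (f \o T) s)%E).
  apply: ge0_subset_integral => //.
  exact: (measurable_funTS (measurableT_comp mf mT)).
rewrite -ge0_integral_pushforward //; last first.
  exact: measurable_funTS.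
pose T' : {mfun mR >-> mR} := HB.pack T (isMeasurableFun.Build _ _ mR mR T mT).
apply: (@ge0_le_measure_integral _ mR R (pushforward leb T') leb) => //.
by move=> S mS; exact: expanding_preimage_le.
Qed.
End expanding_change_of_variables.

(** * Length of curves *)

Section length_of_curves.
Context {R : realType} {d : measure_display} {X : metricMeasurableType R d}.
Implicit Types (gamma c : R -> X) (a b t : R) (s : seq R).

Lemma polygonal_length_nil a b gamma : polygonal_length a b gamma [::] = 0.
Proof. by rewrite /polygonal_length big_nil. Qed.

Lemma polygonal_length_cons a b gamma x s : polygonal_length a b gamma (x :: s) =
  mdist (gamma a) (gamma x) + polygonal_length x b gamma s.
Proof.
rewrite /polygonal_length /= big_nat_recl //=.
Qed.

Lemma polygonal_length_rcons a b b' gamma s x :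
  polygonal_length a b gamma (rcons s x) =
  polygonal_length a b' gamma s + mdist (gamma (last a s)) (gamma x).
Proof.
elim: s a => [|y s IH] a /=.
  by rewrite polygonal_length_cons !polygonal_length_nil addr0 add0r.
by rewrite !polygonal_length_cons IH addrA.
Qed.

Lemma itv_partition_rcons a t t' s : itv_partition a t s -> t < t' ->
  itv_partition a t' (rcons s t').
Proof.
by move=> [pas /eqP st] tt'; split; rewrite ?last_rcons// rcons_path pas st.
Qed.

Lemma curve_length_ge a b gamma s : itv_partition a b s ->
  ((polygonal_length a b gamma s)%:E <= curve_length a b gamma)%E.
Proof. by move=> abs; apply: ereal_sup_ubound; exists s. Qed.

Lemma curve_length_ge0 a b gamma : a <= b -> (0 <= curve_length a b gamma)%E.
Proof.
rewrite le_eqVlt => /orP[/eqP <-|ab].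
  have := @curve_length_ge a a gamma [::]; rewrite polygonal_length_nil; apply.
  by split.
apply: le_trans (curve_length_ge gamma (itv_partition1 ab)).
by rewrite polygonal_length_cons polygonal_length_nil addr0 lee_fin mdist_ge0.
Qed.

Lemma curve_lengthxx a gamma : curve_length a a gamma = 0%E.
Proof.
apply/eqP; rewrite eq_le curve_length_ge0// andbT.
apply: ge_ereal_sup => _ [s /itv_partitionxx -> <-].
by rewrite polygonal_length_nil.
Qed.

Lemma curve_length_superadditive a t t' gamma : a <= t -> t <= t' ->
  (curve_length a t gamma + (mdist (gamma t) (gamma t'))%:E
   <= curve_length a t' gamma)%E.
Proof.
move=> at_; rewrite le_eqVlt => /orP[/eqP <-|tt'].
  by rewrite mdistxx adde0.
rewrite -leeBrDr//; apply: ge_ereal_sup => _ [s ats <-].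
rewrite leeBrDr// -EFinD.
have := curve_length_ge gamma (itv_partition_rcons ats tt').
by case: ats => _ /eqP st; rewrite (polygonal_length_rcons _ _ t) st.
Qed.

Lemma curve_length_le a t t' gamma : a <= t -> t <= t' ->
  (curve_length a t gamma <= curve_length a t' gamma)%E.
Proof.
move=> at_ tt'; apply: le_trans (curve_length_superadditive gamma at_ tt').
by rewrite leeDl// lee_fin mdist_ge0.
Qed.

(** Length is lower semicontinuous: the last vertex of a polygonal line
   inscribed over [a, t] can be moved slightly to the left. *)
Lemma curve_length_left_limit a t gamma (S : R) : a < t ->
  (forall e, 0 < e -> exists2 r, 0 < r &
     forall t', a <= t' -> t - r < t' -> t' < t ->
       mdist (gamma t') (gamma t) <= e) ->
  (forall t', a <= t' -> t' < t -> (curve_length a t' gamma <= S%:E)%E) ->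
  (curve_length a t gamma <= S%:E)%E.
Proof.
move=> at_ ct lS; apply: ge_ereal_sup => _ [s ats <-].
case/lastP: s ats => [/itv_partition_nil/eqP|s x [pasx]].
  by rewrite lt_eqF.
rewrite last_rcons => /eqP xt; subst x.
move: pasx; rewrite rcons_path => /andP[pas lt_].
rewrite lee_fin (polygonal_length_rcons _ _ (last a s)).
apply/ler_addgt0Pr => e e0; have [r r0 ctr] := ct _ e0.
have al : a <= last a s by apply: (@itv_partition_le _ _ _ _ s); split.
pose t' := (Num.max (last a s) (t - r) + t) / 2.
have mt : Num.max (last a s) (t - r) < t by rewrite gt_max lt_ /= ltrBlDr ltrDl.
have lt' : last a s < t'.
  by apply: (le_lt_trans (_ : _ <= Num.max (last a s) (t - r)));
    [rewrite le_max lexx|rewrite midf_lt].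
have rt' : t - r < t'.
  by apply: (le_lt_trans (_ : _ <= Num.max (last a s) (t - r)));
    [rewrite le_max lexx orbT|rewrite midf_lt].
have t't : t' < t by rewrite midf_lt.
have at' : a <= t' by rewrite (le_trans al)// ltW.
have ps : itv_partition a t' (rcons s t').
  by apply: itv_partition_rcons lt'; split.
have := le_trans (curve_length_ge gamma ps) (lS _ at' t't).
rewrite lee_fin (polygonal_length_rcons _ _ (last a s)) => H.
have := ctr _ at' rt' t't.
have := metric_triangle (gamma (last a s)) (gamma t') (gamma t).
by move: H; lra.
Qed.

End length_of_curves.

(** * Curves and 1-Lipschitz paths *)

Section arc_length_parameter.
Context {R : realType} {d : measure_display} {X : metricMeasurableType R d}.
Implicit Types (gamma c : R -> X) (g : X -> \bar R).

(** Paths are defined on the whole line, so that restricting them to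
   subintervals carries no side condition. *)
Definition lip1 c := forall s t, mdist (c s) (c t) <= `|s - t|.

Definition arc_time (a b : R) gamma (s : R) :=
  inf [set t | a <= t <= b /\ (s%:E <= curve_length a t gamma)%E].

Section arc_time_bounds.
Variables (a b : R) (gamma : R -> X) (s : R).
Hypotheses (ab : a <= b) (sb : (s%:E <= curve_length a b gamma)%E).
Let A := [set t | a <= t <= b /\ (s%:E <= curve_length a t gamma)%E].

Let A0 : A !=set0. Proof. by exists b; rewrite /A /= ab lexx. Qed.
Let lbA : lbound A a. Proof. by move=> t [/andP[]]. Qed.

Lemma arc_time_ge : a <= arc_time a b gamma s.
Proof. exact: lb_le_inf. Qed.

Lemma arc_time_le : arc_time a b gamma s <= b.
Proof. by apply: ge_inf; [exists a|rewrite /A /= ab lexx]. Qed.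

Lemma curve_length_lt_arc_time t : a <= t -> t < arc_time a b gamma s ->
  (curve_length a t gamma < s%:E)%E.
Proof.
move=> at_ tT; rewrite ltNge; apply/negP => st.
have tb : t <= b by rewrite (le_trans (ltW tT))// arc_time_le.
suff : arc_time a b gamma s <= t by rewrite leNgt tT.
by apply: ge_inf; [exists a|rewrite /A /= at_ tb].
Qed.

Lemma curve_length_gt_arc_time t : arc_time a b gamma s < t ->
  (s%:E <= curve_length a t gamma)%E.
Proof.
move=> /inf_lt[//|t0 [/andP[at0 _] st0] t0t].
by rewrite (le_trans st0)// curve_length_le// ltW.
Qed.

End arc_time_bounds.

Lemma arc_time_le_mono (a b : R) gamma s s' : a <= b ->
  (s'%:E <= curve_length a b gamma)%E -> s <= s' ->
  arc_time a b gamma s <= arc_time a b gamma s'.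
Proof.
move=> ab s'b ss'; apply: lb_le_inf; first by exists b; rewrite /= ab lexx.
move=> t [abt s't]; apply: ge_inf; first by exists a => u [/andP[]].
by split=> //; apply: le_trans s't; rewrite lee_fin.
Qed.

Lemma within_continuous_itvP (a b : R) gamma (t e : R) :
  {within `[a, b], continuous gamma} -> a <= t <= b -> 0 < e ->
  exists2 r, 0 < r & forall t', a <= t' <= b -> `|t - t'| < r ->
    mdist (gamma t) (gamma t') <= e.
Proof.
move=> /subspace_continuousP /(_ t) ct tab e0.
have /ct /metricType_numDomainType.cvgrPdist_le /(_ _ e0) : `[a, b]%classic t.
  by rewrite /= in_itv.
rewrite near_withinE => /nbhs_ballP[r /= r0 H]; exists r => // t' abt' tt'.
by apply: H => //; rewrite /= in_itv.
Qed.

Section curve_to_path.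
Variables (a b : R) (gamma : R -> X).
Hypothesis curv : is_curve a b gamma.
Let l t := curve_length a t gamma.
Let L := fine (l b).
Let T := arc_time a b gamma.

Let ab : a <= b. Proof. by case: curv. Qed.
Let lbE : l b = L%:E.
Proof.
by rewrite /L fineK// ge0_fin_numE; [case: curv|exact: curve_length_ge0].
Qed.
Let sl s : s <= L -> (s%:E <= l b)%E. Proof. by rewrite lbE lee_fin. Qed.
Let L0 : 0 <= L. Proof. by rewrite -lee_fin -lbE curve_length_ge0. Qed.
Let Tab s : s <= L -> a <= T s <= b.
Proof. by move=> /sl sL; rewrite arc_time_ge ?arc_time_le. Qed.

(* By lower semicontinuity, since the length is less than [s] before [T s]. *)
Let length_arc_time s : 0 <= s -> s <= L -> (l (T s) <= s%:E)%E.
Proof.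
move=> s0 sL; have /andP[aT Tb] := Tab sL.
case: (ltgtP a (T s)) aT => // [aT _|<- _]; last first.
  by rewrite /l curve_lengthxx.
apply: curve_length_left_limit => // [e e0|t' at' t'T]; last first.
  by apply/ltW/(curve_length_lt_arc_time _ (sl sL)).
have [_ cg _] := curv.
have [r r0 H] := within_continuous_itvP cg (Tab sL) e0.
exists r => // t' at' rt' t'T; rewrite metric_sym; apply: H.
  by rewrite at' (le_trans (ltW t'T)).
by rewrite ger0_norm; lra.
Qed.

Let arc_param_lip s s' : 0 <= s -> s <= s' -> s' <= L ->
  mdist (gamma (T s)) (gamma (T s')) <= s' - s.
Proof.
move=> s0 ss' s'L.
have sL := le_trans ss' s'L; have s'0 := le_trans s0 ss'.
have /andP[aT Tb] := Tab sL; have /andP[aT' Tb'] := Tab s'L.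
have := arc_time_le_mono ab (sl s'L) ss'.
rewrite -/T le_eqVlt => /orP[/eqP ->|TT']; first by rewrite mdistxx subr_ge0.
apply/ler_addgt0Pr => e e0; have [_ cg _] := curv.
have [r r0 H] := within_continuous_itvP cg (Tab sL) e0.
pose t := T s + Num.min r (T s' - T s) / 2.
have m0 : 0 < Num.min r (T s' - T s) by rewrite lt_min r0 subr_gt0.
have mr : Num.min r (T s' - T s) <= r by rewrite ge_min lexx.
have mT : Num.min r (T s' - T s) <= T s' - T s by rewrite ge_min lexx orbT.
have Tst : T s < t by rewrite /t; lra.
have tT' : t < T s' by rewrite /t; lra.
have := H t _ _; rewrite (le_trans aT (ltW Tst)) (le_trans (ltW tT') Tb').
have -> : `|T s - t| < r by rewrite ltr0_norm /t; lra.
move=> /(_ isT isT) Hd.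
have at_ : a <= t by rewrite (le_trans aT)// ltW.
have := curve_length_superadditive gamma at_ (ltW tT').
move=> /le_trans/(_ (length_arc_time s'0 s'L)).
have := curve_length_gt_arc_time ab (sl sL) Tst.
move=> /(leeD2r (mdist (gamma t) (gamma (T s')))%:E) H1 /(le_trans H1).
rewrite -EFinD lee_fin.
have := metric_triangle (gamma (T s)) (gamma t) (gamma (T s')).
by move: Hd; lra.
Qed.

Definition clamp (s : R) := Num.max 0 (Num.min s L).

Lemma clamp_itv s : 0 <= clamp s <= L.
Proof. by rewrite /clamp le_max lexx ge_max L0 ge_min lexx orbT. Qed.

Lemma clampE s : 0 <= s <= L -> clamp s = s.
Proof. by move=> /andP[s0 sL]; rewrite /clamp min_l// max_r. Qed.

Lemma le_clamp s t : s <= t -> clamp s <= clamp t.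
Proof. by rewrite /clamp !minEle !maxEle; do 4 case: ifP; lra. Qed.

Lemma clamp_lip s t : s <= t -> clamp t - clamp s <= t - s.
Proof. by rewrite /clamp !minEle !maxEle; do 4 case: ifP; lra. Qed.

Lemma arc_param_start : T 0 = a.
Proof.
apply/eqP; rewrite eq_le (andP (Tab L0)).1 andbT.
apply: ge_inf; first by exists a => u [/andP[]].
by rewrite /= lexx ab curve_lengthxx.
Qed.

Lemma arc_param_end : gamma (T L) = gamma b.
Proof.
apply: mdist_positivity; apply/eqP; rewrite eq_le mdist_ge0 andbT.
have /andP[aT Tb] := Tab (lexx L).
case: (ltgtP (T L) b) Tb => // [TLb _|-> _]; last by rewrite mdistxx.
apply/ler_addgt0Pr => e e0; have [_ cg _] := curv.
have [r r0 H] := within_continuous_itvP cg (Tab (lexx L)) e0.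
pose t := T L + Num.min r (b - T L) / 2.
have m0 : 0 < Num.min r (b - T L) by rewrite lt_min r0 subr_gt0.
have mr : Num.min r (b - T L) <= r by rewrite ge_min lexx.
have mT : Num.min r (b - T L) <= b - T L by rewrite ge_min lexx orbT.
have Tst : T L < t by rewrite /t; lra.
have tb : t < b by rewrite /t; lra.
have := H t _ _; rewrite (le_trans aT (ltW Tst)) (ltW tb).
have -> : `|T L - t| < r by rewrite ltr0_norm /t; lra.
move=> /(_ isT isT) Hd.
have at_ : a <= t by rewrite (le_trans aT)// ltW.
have := curve_length_superadditive gamma at_ (ltW tb).
rewrite -/(l b) lbE.
have := curve_length_gt_arc_time ab (sl (lexx L)) Tst.
move=> /(leeD2r (mdist (gamma t) (gamma b))%:E) H1 /(le_trans H1).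
rewrite -EFinD lee_fin.
have := metric_triangle (gamma (T L)) (gamma t) (gamma b).
by move: Hd; lra.
Qed.

(** The arc-length parametrization of a curve is 1-Lipschitz, and line
   integrals along the curve are integrals along it by definition. *)
Lemma curve_to_path : exists c, [/\ lip1 c, c 0 = gamma a, c L = gamma b &
  forall g, line_integral a b gamma g =
    (\int[lebesgue_measure]_(s in `[0%R, L]) g (c s))%E].
Proof.
exists (fun s => gamma (T (clamp s))); split.
- move=> s t; wlog st : s t / s <= t.
    move=> H; case: (leP s t) => [/H//|/ltW /H].
    by rewrite metric_sym distrC.
  have /andP[s0 sL] := clamp_itv s; have /andP[t0 tL] := clamp_itv t.
  apply: le_trans (arc_param_lip s0 (le_clamp st) tL) _.
  by rewrite ler0_norm ?subr_le0// opprB clamp_lip.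
- by rewrite clampE ?lexx// arc_param_start.
- by rewrite clampE ?lexx ?L0// arc_param_end.
- move=> g; apply: eq_integral => s; rewrite inE /= in_itv/= => sL.
  by rewrite clampE.
Qed.

End curve_to_path.

Section path_to_curve.
Variable c : R -> X.
Hypothesis lc : lip1 c.

Lemma lip1_polygonal_length a b s : itv_partition a b s ->
  polygonal_length a b c s <= b - a.
Proof.
elim: s a => [|x s IH] a abs.
  by rewrite polygonal_length_nil (itv_partition_nil abs) subrr.
have := itv_partition_cons abs; move: abs => [/= /andP[ax _] _] /IH.
rewrite polygonal_length_cons.
by have := lc a x; rewrite ltr0_norm ?subr_lt0//; lra.
Qed.

Lemma lip1_curve_length a b : (curve_length a b c <= (b - a)%:E)%E.
Proof.
by apply: ge_ereal_sup => _ [s abs <-]; rewrite lee_fin lip1_polygonal_length.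
Qed.

Lemma lip1_continuous : continuous c.
Proof.
move=> s; apply/metricType_numDomainType.cvgrPdist_le => e e0.
apply/nbhs_ballP; exists e => //= t; rewrite /ball/= => st.
by rewrite (le_trans (lc _ _))// ltW.
Qed.

Lemma lip1_is_curve a b : a <= b -> is_curve a b c.
Proof.
move=> ab; split=> //; last exact: le_lt_trans (lip1_curve_length a b) (ltry _).
by apply: continuous_subspaceT; exact: lip1_continuous.
Qed.

(** Split a partition of [a, t'] at [t]; the part beyond [t] has polygonal
   length at most [t' - t]. *)
Lemma lip1_curve_length_split a t t' : a <= t -> t <= t' ->
  (curve_length a t' c <= curve_length a t c + (t' - t)%:E)%E.
Proof.
move=> at_ tt'; apply: ge_ereal_sup => _ [s ats <-].
suff [s' as' H] : exists2 s', itv_partition a t s' &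
    polygonal_length a t' c s <= polygonal_length a t c s' + (t' - t).
  apply: le_trans (leeD2r _ (curve_length_ge c as')).
  by rewrite -EFinD lee_fin.
elim: s a at_ ats => [|x s IH] a at_ ats.
  have at' := itv_partition_nil ats.
  have ta : t = a by apply/eqP; rewrite eq_le at_ at' tt'.
  by exists [::]; [split => //=; rewrite ta|rewrite !polygonal_length_nil; lra].
have xts := itv_partition_cons ats; move: (ats) => [/= /andP[ax pxs] xt'].
have [xt|tx] := leP x t.
  have [s' xs' H] := IH _ xt xts; exists (x :: s').
    by case: xs' => ? ?; split => //=; apply/andP.
  by rewrite !polygonal_length_cons -addrA lerD2l.
have H := lip1_polygonal_length xts.
have := metric_triangle (c a) (c t) (c x).
have := lc t x; rewrite ltr0_norm ?subr_lt0//.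
case: (ltgtP a t) at_ => // [at_ _|<- _].
  exists [:: t]; first exact: itv_partition1.
  by rewrite !polygonal_length_cons polygonal_length_nil; lra.
exists [::]; first by split.
by rewrite polygonal_length_cons polygonal_length_nil; lra.
Qed.

Local Notation mR := (measurableTypeR R).

Lemma lip1_measurable g : borel_fun g -> measurable_fun setT (g \o c : mR -> \bar R).
Proof.
move=> bg _ B mB; rewrite setTI.
suff H : <<s @open X >> `<=` [set A | measurable (c @^-1` A : set mR)].
  exact: H (bg _ mB).
apply: smallest_sub.
  split => /=.
  - by rewrite preimage_set0.
  - by move=> A mA; rewrite setTD preimage_setC; exact: measurableC.
  - by move=> F mF; rewrite preimage_bigcup; exact: bigcup_measurable.
move=> A oA /=; apply: open_measurable.
by move/continuousP: lip1_continuous; exact.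
Qed.

(** Extending [arc_time] with unit speed outside [0, l] makes it expanding on
   the whole line. *)
Let arc_time_ext (a b l s : R) : R :=
  if s < 0 then a + s else if s <= l then arc_time a b c s else b + (s - l).

(** A 1-Lipschitz path may be traversed at less than unit speed, so its
   parameter overestimates arc length: the first time at which the length
   reaches [s] is an expanding function of [s]. *)
Lemma lip1_line_integral a b g : a <= b -> borel_fun g -> (forall x, 0 <= g x)%E ->
  (line_integral a b c g <= \int[lebesgue_measure]_(t in `[a, b]) g (c t))%E.
Proof.
move=> ab bg g0; set l := fine (curve_length a b c).
have lE : curve_length a b c = l%:E.
  rewrite /l fineK// ge0_fin_numE; last exact: curve_length_ge0.
  exact: le_lt_trans (lip1_curve_length a b) (ltry _).
have l0 : 0 <= l by rewrite -lee_fin -lE curve_length_ge0.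
have lab : l <= b - a by rewrite -lee_fin -lE lip1_curve_length.
pose T := arc_time_ext a b l.
have sl s : s <= l -> (s%:E <= curve_length a b c)%E by rewrite lE lee_fin.
have Tab s : s <= l -> a <= arc_time a b c s <= b.
  by move=> /sl sL; rewrite arc_time_ge ?arc_time_le.
have len s : 0 <= s -> s <= l ->
    (curve_length a (arc_time a b c s) c <= s%:E)%E.
  move=> s0 sL; have /andP[aT Tb] := Tab _ sL.
  case: (ltgtP a (arc_time a b c s)) aT => // [aT _|<- _]; last first.
    by rewrite curve_lengthxx.
  apply: curve_length_left_limit => // [e e0|t' at' t'T]; last first.
    by apply/ltW/(curve_length_lt_arc_time ab (sl _ sL)).
  exists e => // t' at' rt' t'T.
  by rewrite (le_trans (lc _ _))// ltr0_norm ?subr_lt0//; lra.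
have exT s t : s <= t -> t - s <= T t - T s.
  have H s' t' : 0 <= s' -> s' <= t' -> t' <= l ->
      t' - s' <= arc_time a b c t' - arc_time a b c s'.
    move=> s0 st tl; have sl' := le_trans st tl.
    have TT := arc_time_le_mono ab (sl _ tl) st.
    have /andP[aT Tb] := Tab _ sl'; have /andP[aT' Tb'] := Tab _ tl.
    apply/ler_addgt0Pr => e e0.
    have := curve_length_gt_arc_time ab (sl _ tl)
      (_ : arc_time a b c t' < arc_time a b c t' + e).
    rewrite ltrDl => /(_ e0) H1.
    have TTe : arc_time a b c s' <= arc_time a b c t' + e by lra.
    have H2 := lip1_curve_length_split aT TTe.
    have := le_trans (le_trans H1 H2) (leeD2r _ (len _ s0 sl')).
    by rewrite -EFinD lee_fin; lra.
  move=> st; rewrite /T /arc_time_ext.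
  case: (ltP s 0) => s0; case: (ltP t 0) => t0; try lra.
  - case: (leP t l) => tl; last lra.
    by have := H 0 t (lexx 0) t0 tl; have := Tab 0 l0; lra.
  - case: (leP s l) => sl'; case: (leP t l) => tl; try lra.
      exact: H.
    have := H s l s0 sl' (lexx l); have := Tab l (lexx l); lra.
have exT' s t : `|s - t| <= `|T s - T t|.
  wlog st : s t / s <= t.
    move=> G; case: (leP s t) => [/G//|/ltW /G].
    by rewrite distrC [leRHS]distrC.
  rewrite distrC [leRHS]distrC ger0_norm ?subr_ge0//.
  by rewrite (le_trans (exT _ _ st))// ler_norm.
have mT : measurable_fun setT (T : mR -> mR).
  apply: nondecreasing_measurable => //= s t st.
  by have := exT _ _ st; lra.
rewrite /line_integral -/l.
rewrite (eq_integral (fun s : mR => (g \o c) (T s))); last first.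
  move=> s; rewrite inE /= in_itv/= => /andP[s0 sL].
  by rewrite /T /arc_time_ext ltNge s0/= sL.
apply: (@ge0_integral_expanding R T `[0, l]%classic `[a, b]%classic (g \o c)) => //.
- move=> s /=; rewrite !in_itv/= => /andP[s0 sL].
  by rewrite /T /arc_time_ext ltNge s0/= sL Tab.
- exact: lip1_measurable.
- by move=> t; exact: g0.
Qed.

End path_to_curve.
End arc_length_parameter.

(** * Paths of given cost *)

Section paths.
Context {R : realType} {d : measure_display} {X : metricMeasurableType R d}.
Implicit Types (c : R -> X) (g : X -> \bar R) (x y : X) (E : set X).
Local Notation mR := (measurableTypeR R).
Local Notation leb := (@lebesgue_measure R).

Lemma borel_funP g :
  borel_fun g <-> measurable_fun setT (g : g_sigma_algebraType (@open X) -> \bar R).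
Proof.
split=> [bg _ B mB|mg B mB]; first by rewrite setTI; exact: bg.
by have := mg measurableT B mB; rewrite setTI.
Qed.

Definition path_cost g (L : R) c := (\int[leb]_(s in `[0%R, L]) g (c s))%E.

(** An explicit bound [C] on the cost, rather than an infimum over paths: such
   bounds add up under concatenation. *)
Definition joins g x E (C : R) := exists c L,
  [/\ lip1 c, 0 <= L, c 0 = x, E (c L) & (path_cost g L c <= C%:E)%E].

Lemma joins_le g x E (C C' : R) : C <= C' -> joins g x E C -> joins g x E C'.
Proof.
move=> CC' [c [L [lc L0 c0 cL gc]]]; exists c, L; split => //.
by apply: le_trans gc _; rewrite lee_fin.
Qed.

Lemma path_cost0 g c : path_cost g 0 c = 0%E.
Proof. by rewrite /path_cost set_itv1 integral_set1. Qed.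

Lemma joins_refl g x E : E x -> joins g x E 0.
Proof.
move=> Ex; exists (cst x), 0; split => //; last by rewrite path_cost0.
by move=> s t; rewrite mdistxx.
Qed.

(** The paths are concatenated; the translation of the parameter of the second
   one is expanding. *)
Lemma joins_trans g x y E (C C' : R) : borel_fun g -> (forall x, 0 <= g x)%E ->
  joins g x [set y] C -> joins g y E C' -> joins g x E (C + C').
Proof.
move=> bg g0 [c1 [L1 [l1 L10 c10 c1L g1]]] [c2 [L2 [l2 L20 c20 c2L g2]]].
pose c s := if s <= L1 then c1 s else c2 (s - L1).
have c12 : c1 L1 = c2 0 by rewrite c1L c20.
have lc : lip1 c.
  move=> s t; wlog st : s t / s <= t.
    move=> H; case: (leP s t) => [/H//|/ltW /H].
    by rewrite metric_sym distrC.
  rewrite /c; case: (leP s L1) => sL; case: (leP t L1) => tL.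
  - exact: l1.
  - have := metric_triangle (c1 s) (c1 L1) (c2 (t - L1)).
    have := l1 s L1; rewrite ler0_norm ?subr_le0//.
    have := l2 0 (t - L1); rewrite ler0_norm ?sub0r ?oppr_le0 ?subr_ge0 ?(ltW tL)//.
    by rewrite -c12 ler0_norm ?subr_le0//; lra.
  - lra.
  - by have := l2 (s - L1) (t - L1); rewrite opprB addrA subrK.
exists c, (L1 + L2); split => //.
- by rewrite addr_ge0.
- by rewrite /c L10.
- rewrite /c; case: (leP (L1 + L2) L1) => H; last by rewrite addrAC subrr add0r.
  have L2E : L2 = 0 by lra.
  by rewrite L2E addr0 c12; rewrite L2E in c2L.
have mg (c' : R -> X) : lip1 c' -> measurable_fun setT (g \o c' : mR -> \bar R).
  by move=> lc'; exact: lip1_measurable.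
rewrite /path_cost.
have -> : `[0, L1 + L2]%classic = `[0, L1] `|` `]L1, L1 + L2] :> set mR.
  apply/seteqP; split => s /=; rewrite !in_itv/=.
    by case: (leP s L1) => [sL /andP[-> _]|_ /andP[_ ->]]; [left|right].
  by case=> /andP[]; lra.
rewrite ge0_integral_setU//=; last 2 first.
- by apply: measurable_funTS; exact: mg.
- by apply/disj_setPS => s /= []; rewrite !in_itv/= => /andP[_ sL] /andP[]; lra.
rewrite EFinD; apply: leeD.
  apply: le_trans g1; rewrite /path_cost le_eqVlt; apply/orP; left; apply/eqP.
  apply: eq_integral => s; rewrite inE /= in_itv/= => /andP[_ sL].
  by rewrite /c sL.
apply: le_trans g2; rewrite /path_cost.
rewrite (eq_integral (fun s : mR => (g \o c2) (s - L1))); last first.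
  by move=> s; rewrite inE /= in_itv/= => /andP[sL _]; rewrite /c leNgt sL.
apply: (@ge0_integral_expanding R (fun s : mR => s - L1) _ _ (g \o c2)) => //.
- apply: nondecreasing_measurable => //= s t st; lra.
- by move=> s t /=; rewrite opprB addrA subrK.
- by move=> s /=; rewrite !in_itv/=; lra.
- exact: mg.
- by move=> s; exact: g0.
Qed.

Lemma joins_sym g x y (C : R) : borel_fun g -> (forall x, 0 <= g x)%E ->
  joins g x [set y] C -> joins g y [set x] C.
Proof.
move=> bg g0 [c [L [lc L0 c0 cL gc]]].
exists (fun s => c (L - s)), L; split => //.
- move=> s t; apply: le_trans (lc _ _) _.
  by rewrite opprB addrC addrA subrK distrC.
- by rewrite subr0.
- by rewrite /= subrr.
apply: le_trans gc; rewrite /path_cost.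
apply: (@ge0_integral_expanding R (fun s : mR => L - s) _ _ (g \o c)) => //.
- apply: (measurable_funB (f := cst L) (g := id)) => //.
- by move=> s t /=; rewrite opprB [L - s + _]addrC addrA subrK distrC.
- by move=> s /=; rewrite !in_itv/=; lra.
- exact: lip1_measurable.
- by move=> s; exact: g0.
Qed.

Lemma joins_curve g (nu : R) x y (C : R) :
  (ereal_inf [set line_integral c.1.1 c.1.2 c.2 g | c in curves_between nu x y]
     < C%:E)%E -> joins g x [set y] C.
Proof.
move=> /ereal_inf_lt[_ [[[a b] gamma] [curv ga gb _] <-] /= gC].
have [c [lc c0 cL gc]] := curve_to_path curv.
exists c, (fine (curve_length a b gamma)); split => //.
- by rewrite fine_ge0// curve_length_ge0; case: curv.
- by rewrite c0.
- by rewrite /= cL.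
- by rewrite /path_cost -gc ltW.
Qed.

Lemma path_cost_le g (M L : R) c : lip1 c -> borel_fun g -> (forall x, 0 <= g x)%E ->
  (forall x, g x <= M%:E)%E -> 0 <= L -> (path_cost g L c <= (M * L)%:E)%E.
Proof.
move=> lc bg g0 gM L0; rewrite /path_cost.
apply: (@le_trans _ _ (\int[leb]_(s in `[0%R, L]) (M%:E))%E).
  apply: ge0_le_integral => //.
  by apply: measurable_funTS; exact: lip1_measurable.
rewrite integral_cst//= lebesgue_measure_itv/= lte_fin.
case: ifP => [_|]; first by rewrite oppr0 addr0 EFinM.
by rewrite mule0 lee_fin; move: (gM (c 0)) (g0 (c 0)) => /[swap] /le_trans/[apply];
  rewrite lee_fin => M0; rewrite mulr_ge0.
Qed.

Lemma joins_quasiconvex g (M CQC : R) x y : quasiconvex X CQC ->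
  borel_fun g -> (forall x, 0 <= g x)%E -> (forall x, g x <= M%:E)%E ->
  joins g x [set y] (M * (CQC * mdist x y)).
Proof.
move=> qc bg g0 gM; have [[[a b] gamma] [curv ga gb len]] := qc x y.
have M0 : 0 <= M by rewrite -lee_fin; exact: le_trans (g0 x) (gM x).
have l0 : (0 <= curve_length a b gamma)%E.
  by apply: curve_length_ge0; case: curv.
have lE : curve_length a b gamma = (fine (curve_length a b gamma))%:E.
  by rewrite fineK// ge0_fin_numE//; case: curv.
have [c [lc c0 cL gc]] := curve_to_path curv.
exists c, (fine (curve_length a b gamma)); split => //.
- by rewrite fine_ge0.
- by rewrite c0.
- by rewrite /= cL.
apply: le_trans (path_cost_le lc bg g0 gM _) _; first by rewrite fine_ge0.
by rewrite lee_fin ler_wpM2l// -lee_fin -lE.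
Qed.

End paths.

(** * Distances, densities and the Vitali covering lemma *)

Section distance_to_a_set.
Context {R : realType} {d : measure_display} {X : metricMeasurableType R d}.
Implicit Types (x y z : X) (E : set X).

Lemma mdist_set_lbound E x : lbound [set mdist x y | y in E] 0.
Proof. by move=> _ [y _ <-]; exact: mdist_ge0. Qed.

Lemma mdist_set_le E x z : E z -> mdist_set x E <= mdist x z.
Proof.
move=> Ez; apply: ge_inf; last by exists z.
by exists 0; exact: mdist_set_lbound.
Qed.

Lemma mdist_set_adherent E x (e : R) : E !=set0 -> 0 < e ->
  exists2 z, E z & mdist x z < mdist_set x E + e.
Proof.
move=> [z0 Ez0] e0.
have [|_ [z Ez <-] H] := @inf_adherent _ [set mdist x y | y in E] e e0.
  by split; [exists (mdist x z0), z0|exists 0; exact: mdist_set_lbound].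
by exists z.
Qed.

Lemma mdist_set_triangle E x y : E !=set0 ->
  mdist_set x E <= mdist x y + mdist_set y E.
Proof.
move=> E0; apply/ler_addgt0Pr => e e0.
have [z Ez H] := mdist_set_adherent y E0 e0.
have := mdist_set_le x Ez; have := metric_triangle x y z; lra.
Qed.

Lemma mdist_set_ge0 E x : E !=set0 -> 0 <= mdist_set x E.
Proof.
move=> [z Ez]; apply: lb_le_inf; first by exists (mdist x z), z.
exact: mdist_set_lbound.
Qed.

Lemma mdist_setC_gt0 E x : open E -> ~` E !=set0 -> E x -> 0 < mdist_set x (~` E).
Proof.
move=> oE E0 Ex; have /nbhs_ballP[r /= r0 rE] : nbhs x E by exact: open_nbhs_nbhs.
apply: (lt_le_trans r0); apply: lb_le_inf.
  by case: E0 => z Ez; exists (mdist x z), z.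
move=> _ [z Ez <-]; rewrite leNgt; apply/negP => zr; apply: Ez; apply: rE.
by rewrite ballEmdist.
Qed.

Lemma mdist_setC_lt E x y : mdist x y < mdist_set x (~` E) -> E y.
Proof.
move=> xy; apply: contrapT => Ey.
by move: xy; rewrite ltNge mdist_set_le.
Qed.

Lemma metric_ball_open x (r : R) : open (ball x r).
Proof.
rewrite openE => y; rewrite ballEmdist /= => xy.
apply/nbhs_ballP; exists (r - mdist x y) => /=; first by rewrite subr_gt0.
move=> z; rewrite !ballEmdist/= => yz.
by rewrite (le_lt_trans (metric_triangle x y z))// -ltrBrDl.
Qed.

Lemma ball_subset x y (r s : R) : mdist x y + s <= r -> ball y s `<=` ball x r.
Proof.
move=> H z; rewrite !ballEmdist /= => yz.
by have := metric_triangle x y z; lra.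
Qed.

End distance_to_a_set.

Section integral_as_a_measure.
Local Open Scope ereal_scope.
Context d (T : measurableType d) (R : realType) (mu : {measure set T -> \bar R}).

Lemma integral_measure_ex (f : T -> \bar R) : (forall x, 0 <= f x) ->
  measurable_fun setT f ->
  exists nu : {measure set T -> \bar R}, forall A, nu A = \int[mu]_(x in A) f x.
Proof.
move=> f0 mf; pose m (A : set T) := \int[mu]_(x in A) f x.
have m0 : m set0 = 0 by exact: integral_set0.
have m_ge0 A : 0 <= m A by exact: integral_ge0.
have m_add : semi_sigma_additive m by exact: semi_sigma_additive_nng_induced.
pose nu : {measure set T -> \bar R} := HB.pack m (isMeasure.Build _ _ _ m m0 m_ge0 m_add).
by exists nu.
Qed.

End integral_as_a_measure.

Section vitali.
Context {R : realType} {d : measure_display} {X : metricMeasurableType R d}.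
Variable mu : {measure set X -> \bar R}.
Implicit Types (x y z : X) (F : set (X * R)).
Hypotheses (borel_measurable : @borel R d X `<=` measurable) (mu_doubling : doubling mu).

Lemma measurable_ball x (r : R) : measurable (ball x r).
Proof.
by apply: borel_measurable; apply: sub_sigma_algebra; exact: metric_ball_open.
Qed.

(** By doubling, disjoint balls of radius at least [s] in a fixed ball have
   measures bounded below, and finite total measure. *)
Lemma doubling_disjoint_balls x (r s : R) (b : nat -> X * R) : 0 < s ->
  (forall n, s <= (b n).2) -> (forall n, ball (b n).1 (b n).2 `<=` ball x r) ->
  trivIset setT (fun n => ball (b n).1 (b n).2) -> False.
Proof.
move=> s0 sb bx tb; have [D [D1 HD]] := mu_doubling.
have D0 : 0 < D by lra.
have dbl m y t : 0 < t -> (mu (ball y (2 ^+ m * t)) <= (D ^+ m)%:E * mu (ball y t))%E.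
  move=> t0; elim: m => [|m IH]; first by rewrite !expr0 mul1r mul1e.
  rewrite !exprS -mulrA.
  have t2 : 0 < 2 ^+ m * t by rewrite mulr_gt0// exprn_gt0.
  have [_ _ /le_trans] := HD y _ t2.
  by apply; rewrite EFinM -muleA lee_pmul2l// lte_fin.
have bc n : ball x r (b n).1.
  by apply: (bx n); rewrite ballEmdist /= mdistxx; exact: lt_le_trans (sb n).
have r0 : 0 < r.
  by move: (bc 0%N); rewrite ballEmdist /=; exact: le_lt_trans (mdist_ge0 _ _).
pose m := (Num.truncn (2 * r / s)).+1.
have m2 : 2 * r <= 2 ^+ m * s.
  rewrite -ler_pdivrMr//; apply: le_trans (ltW (truncnS_gt _)) _.
  by rewrite -natrX ler_nat ltnW// ltn_expl.
have [xr0 xroo _] := HD x r r0.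
have big n : (mu (ball x r) <= (D ^+ m)%:E * mu (ball (b n).1 (b n).2))%E.
  have bn0 : 0 < (b n).2 by exact: lt_le_trans (sb n).
  apply: le_trans (dbl m _ _ bn0); apply: le_measure; rewrite ?inE;
    try exact: measurable_ball.
  apply: ball_subset; move: (bc n); rewrite ballEmdist /= metric_sym => H.
  have : 2 ^+ m * s <= 2 ^+ m * (b n).2 by rewrite ler_pM2l// exprn_gt0.
  by lra.
pose a := fine (mu (ball x r)).
have aE : mu (ball x r) = a%:E by rewrite /a fineK// ge0_fin_numE.
have a0 : 0 < a by rewrite -lte_fin -aE.
pose e := a / D ^+ m.
have Dm0 : 0 < D ^+ m by rewrite exprn_gt0.
have e0 : 0 < e by rewrite divr_gt0.
have big' n : (e%:E <= mu (ball (b n).1 (b n).2))%E.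
  by have := big n; rewrite aE /e mulrC EFinM -lee_pdivrMl.
have H N : ((N%:R * e)%:E <= a%:E)%E.
  rewrite -aE; apply: (@le_trans _ _ (\sum_(0 <= n < N) mu (ball (b n).1 (b n).2))%E).
    elim: N => [|N IH]; first by rewrite big_geq// mul0r.
    rewrite big_nat_recr//= -natr1 mulrDl mul1r EFinD.
    by apply: leeD.
  apply: le_trans (nneseries_lim_ge _ _) _ => //.
  rewrite -measure_semi_bigcup//; last 2 first.
  - by move=> n; exact: measurable_ball.
  - by apply: bigcup_measurable => n _; exact: measurable_ball.
  apply: le_measure; rewrite ?inE; first by apply: bigcup_measurable => n _; exact: measurable_ball.
    exact: measurable_ball.
  by apply: bigcup_sub => n _; exact: bx.
have := H (Num.truncn (a / e)).+1; rewrite lee_fin -ler_pdivlMr// leNgt.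
by rewrite truncnS_gt.
Qed.

(** The greedy selection may stop; [None] stands for the empty ball from then on,
   so that selections are indexed by [nat]. *)
Definition scaled_ball (k : R) (o : option (X * R)) : set X :=
  if o is Some p then ball p.1 (k * p.2) else set0.

(** Vitali's covering lemma. Greedy choice: among the balls disjoint from the
   previous ones, take one whose radius is at least half the supremum of the
   available radii. A ball disjoint from all selected ones would bound their
   radii below, against [doubling_disjoint_balls]; hence it meets a selected ball
   of at least half its radius, whose fivefold enlargement contains it. *)
Lemma vitali_covering F x (r : R) :
  (forall p, F p -> 0 < p.2 /\ ball p.1 p.2 `<=` ball x r) ->
  (exists M : R, forall p, F p -> p.2 <= M) ->
  exists b : nat -> option (X * R),
  [/\ forall n p, b n = Some p -> F p,
      trivIset setT (fun n => scaled_ball 1 (b n)) &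
      \bigcup_(p in F) ball p.1 p.2 `<=` \bigcup_n scaled_ball 5 (b n)].
Proof.
move=> Fx [M FM].
pose A (S : seq (X * R)) := [set p | F p /\
  forall q, q \in S -> ball p.1 p.2 `&` ball q.1 q.2 = set0].
have pickP S : exists o, if o is Some p then A S p /\ (forall q, A S q -> q.2 <= 2 * p.2)
    else A S = set0.
  case: (pselect (A S !=set0)) => [[p0 Ap0]|/nonemptyPn]; last by exists None.
  pose rad := [set p.2 | p in A S].
  have rad_sup : has_sup rad.
    split; first by exists p0.2, p0.
    by exists M => _ [p [Fp _] <-]; exact: FM.
  have s0 : 0 < sup rad.
    have [+ _] := Fx _ Ap0.1; move=> /lt_le_trans; apply.
    by apply: ub_le_sup; [case: rad_sup|exists p0].
  have [|_ [p Ap <-] Hp] := @sup_adherent _ rad (sup rad / 2) _ rad_sup.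
    by rewrite divr_gt0.
  exists (Some p); split => // q Aq.
  have : q.2 <= sup rad by apply: ub_le_sup; [case: rad_sup|exists q].
  by lra.
have [pick {}pickP] := choice pickP.
pose pre := fix pre n : seq (X * R) := if n is n'.+1 then
  (if pick (pre n') is Some p then rcons (pre n') p else pre n') else [::].
pose b n := pick (pre n).
have preS n : pre n.+1 = if b n is Some p then rcons (pre n) p else pre n by [].
have pre_mem m n p : (m < n)%N -> b m = Some p -> p \in pre n.
  move=> + bm; elim: n => // n IH; rewrite ltnS leq_eqVlt preS => /orP[/eqP <-|/IH].
    by rewrite bm mem_rcons mem_head.
  by case: (b n) => // q; rewrite mem_rcons inE orbC => ->.
have bF n p : b n = Some p -> F p.
  by move=> bn; have := pickP (pre n); rewrite -/(b n) bn => -[[]].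
have tb : trivIset setT (fun n => scaled_ball 1 (b n)).
  have H m n : (m < n)%N -> scaled_ball 1 (b m) `&` scaled_ball 1 (b n) = set0.
    move=> mn; case bm : (b m) => [p|]; last by rewrite set0I.
    case bn : (b n) => [q|]; last by rewrite setI0.
    have := pickP (pre n); rewrite -/(b n) bn => -[[_ +] _].
    by move=> /(_ p (pre_mem _ _ _ mn bm)); rewrite /= !mul1r setIC.
  apply/trivIsetP => m n _ _; rewrite neq_ltn => /orP[|] /H //.
  by rewrite setIC.
exists b; split => // z [[y s] Fp /= yz].
have [s0 sx] := Fx _ Fp; simpl in s0, sx.
case: (pselect (forall n, A (pre n) (y, s))) => [Aall|].
  exfalso.
  have bsome n : exists p, b n = Some p /\ s <= 2 * p.2.
    have := pickP (pre n); rewrite -/(b n); case: (b n) => [p [_ /(_ _ (Aall n))]|A0].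
      by exists p.
    by have := Aall n; rewrite A0.
  have [p Hp] := choice bsome.
  apply: (@doubling_disjoint_balls x r (s / 2) p).
  - by rewrite divr_gt0.
  - by move=> n; have [_] := Hp n; lra.
  - by move=> n; have [/bF/Fx[]] := Hp n.
  - move: tb; congr (trivIset _ _); apply/funext => n.
    by have [-> _] := Hp n; rewrite /= mul1r.
move=> /existsNP nA; have [n An nmin] : exists2 n, ~ A (pre n) (y, s) &
    forall m, (m < n)%N -> A (pre m) (y, s).
  have [n /asboolP An nmin] := @ex_minnP (fun n => `[< ~ A (pre n) (y, s) >])
     (let: ex_intro n An := nA in ex_intro _ n (introT (asboolP _) An)).
  exists n => // m mn; apply: contrapT => /asboolP /nmin.
  by rewrite leqNgt mn.
case: n An nmin => [[]|n An nmin]; first by split.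
have An' := nmin n (ltnSn n).
have := pickP (pre n); rewrite -/(b n); case bn : (b n) => [p|]; last first.
  by move=> A0; move: An'; rewrite A0.
move=> [_ /(_ _ An') /= sp].
have [u [yu pu]] : ball y s `&` ball p.1 p.2 !=set0.
  apply/set0P/eqP => yp0; apply: An; split => // q; rewrite preS bn mem_rcons inE.
  by move=> /orP[/eqP -> //|]; case: An' => _; exact.
exists n => //; rewrite bn /=; move: yz yu pu; rewrite !ballEmdist /= => yz yu pu.
have := metric_triangle p.1 u z; have := metric_triangle u y z.
by rewrite (metric_sym u y); lra.
Qed.

(** The covering half of the weak type estimate for maximal functions. *)
Lemma vitali_measure_le (w nu : {measure set X -> \bar R}) F x (r C l : R) :
  0 <= C -> 0 <= l ->
  (forall p, F p -> 0 < p.2 /\ ball p.1 p.2 `<=` ball x r) ->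
  (exists M : R, forall p, F p -> p.2 <= M) ->
  (forall p, F p -> w (ball p.1 (5 * p.2)) <= C%:E * w (ball p.1 p.2))%E ->
  (forall p, F p -> w (ball p.1 p.2) <= l%:E * nu (ball p.1 p.2))%E ->
  (w (\bigcup_(p in F) ball p.1 p.2) <= (C * l)%:E * nu (ball x r))%E.
Proof.
move=> C0 l0 Fx FM wd wnu; have [b [bF tb cov]] := vitali_covering Fx FM.
have mb k n : measurable (scaled_ball k (b n)).
  by case: (b n) => [p|]; [exact: measurable_ball|exact: measurable0].
have mF : measurable (\bigcup_(p in F) ball p.1 p.2).
  apply: borel_measurable; apply: sub_sigma_algebra; apply: bigcup_open => p _.
  exact: metric_ball_open.
apply: (@le_trans _ _ (\sum_(n <oo) w (scaled_ball 5 (b n)))%E).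
  apply: measure_sigma_subadditive => //.
apply: (@le_trans _ _ (\sum_(n <oo) ((C * l)%:E * nu (scaled_ball 1 (b n))))%E).
  apply: lee_nneseries => // n _.
  case bn : (b n) => [p|]; last by rewrite /= !measure0 mule0.
  have Fp := bF _ _ bn; rewrite /= mul1r.
  apply: le_trans (wd _ Fp) _; rewrite EFinM -muleA.
  by apply: lee_wpmul2l; [rewrite lee_fin|exact: wnu].
rewrite nneseriesZl//.
apply: lee_wpmul2l; first by rewrite lee_fin mulr_ge0.
rewrite -measure_semi_bigcup//; last by apply: bigcup_measurable => n _; exact: mb.
apply: le_measure; rewrite ?inE; first by apply: bigcup_measurable => n _; exact: mb.
  exact: measurable_ball.
apply: bigcup_sub => n _; case bn : (b n) => [p|]; last exact: sub0set.
rewrite /= mul1r.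
by have [_] := Fx _ (bF _ _ bn).
Qed.

End vitali.

(** * Hardy inequalities and cheap paths *)

Section hardy_to_paths.
Context {R : realType} {d : measure_display} {X : metricMeasurableType R d}.
Variables (mu : {measure set X -> \bar R}) (CQC : R) (Omega : set X).
Hypotheses (qc : quasiconvex X CQC) (Omega_proper : ~` Omega !=set0).
Implicit Types (x y z : X).

Section distance.
Variables (g : X -> \bar R) (M : R).
Hypotheses (bg : borel_fun g) (g0 : forall x, (0 <= g x)%E)
  (gM : forall x, (g x <= M%:E)%E).

(** The distance to the complement of [Omega] in the metric with density [g]. It
   is an admissible function for the Hardy inequality, with upper gradient [g]. *)
Definition path_dist x : R := inf [set C | joins g x (~` Omega) C].

Let M0 : 0 <= M.
Proof.
by have [z _] := Omega_proper; rewrite -lee_fin; exact: le_trans (g0 z) (gM z).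
Qed.

Let joins_ge0 x E C : joins g x E C -> 0 <= C.
Proof.
by move=> [c [L [_ _ _ _ H]]]; rewrite -lee_fin; apply: le_trans H; exact: integral_ge0.
Qed.

Let dist_has_inf x : has_inf [set C | joins g x (~` Omega) C].
Proof.
split; last by exists 0 => C; exact: joins_ge0.
have [z Oz] := Omega_proper; exists (M * (CQC * mdist x z)) => /=.
have [c [L [? ? ? cz ?]]] := joins_quasiconvex x z qc bg g0 gM.
by exists c, L; split => //; rewrite cz.
Qed.

Lemma path_dist_ge0 x : 0 <= path_dist x.
Proof.
by apply: lb_le_inf; [case: (dist_has_inf x)|move=> C; exact: joins_ge0].
Qed.

Lemma path_dist_le x y C : joins g x [set y] C -> path_dist x <= C + path_dist y.
Proof.
move=> xy; rewrite -lerBlDl; apply: lb_le_inf; first by case: (dist_has_inf y).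
move=> C' yC; rewrite lerBlDl; apply: ge_inf; first by case: (dist_has_inf x).
exact: joins_trans xy yC.
Qed.

Lemma path_dist_lip x y : `|path_dist x - path_dist y| <= M * CQC * mdist x y.
Proof.
have xy := joins_quasiconvex x y qc bg g0 gM.
have yx := joins_sym bg g0 xy.
have := path_dist_le xy; have := path_dist_le yx.
by rewrite ler_norml -!mulrA; lra.
Qed.

Lemma path_dist_out x : (~` Omega) x -> path_dist x = 0.
Proof.
move=> Ox; apply/eqP; rewrite eq_le path_dist_ge0 andbT.
by apply: ge_inf; [case: (dist_has_inf x)|exact: joins_refl].
Qed.

Lemma path_dist_upper_gradient : upper_gradient path_dist g.
Proof.
split => // a b gamma curv.
have [c [lc c0 cL /(_ g) gc]] := curve_to_path curv.
have I0 : (0 <= line_integral a b gamma g)%E by exact: integral_ge0.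
case gE : (line_integral a b gamma g) => [C| |]; last 2 first.
- exact: leey.
- by rewrite gE in I0.
have xy : joins g (gamma a) [set (gamma b)] C.
  exists c, (fine (curve_length a b gamma)); split => //.
    by rewrite fine_ge0// curve_length_ge0; case: curv.
  by rewrite /path_cost -gc gE.
have yx := joins_sym bg g0 xy.
have := path_dist_le xy; have := path_dist_le yx.
by rewrite lee_fin ler_norml; lra.
Qed.

Lemma path_dist_lt x C : path_dist x < C -> joins g x (~` Omega) C.
Proof.
move=> /inf_lt[]; first by case: (dist_has_inf x).
by move=> C' /= xC' /ltW; move: xC' => /[swap]; exact: joins_le.
Qed.

End distance.

(** The Hardy inequality applied to [path_dist]: it turns a bound on averages of
   [g] into a cheap path to the complement of [Omega]. *)
Lemma hardy_joins (p CH kappa : R) (w : X -> \bar R) :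
  (forall (u : X -> R) (g : X -> \bar R), lip0 Omega u ->
      upper_gradient u g -> (exists M : R, forall x, (g x <= M%:E)%E) ->
      forall x, Omega x ->
        (`|u x|%:E <= (CH * mdist_set x (~` Omega))%:E * maximal mu Omega p w kappa g x)%E) ->
  forall (g : X -> \bar R) (M : R), borel_fun g -> (forall x, 0 <= g x)%E ->
  (forall x, g x <= M%:E)%E -> forall x C, Omega x ->
  ((CH * mdist_set x (~` Omega))%:E * maximal mu Omega p w kappa g x < C%:E)%E ->
  joins g x (~` Omega) C.
Proof.
move=> hardy g M bg g0 gM x C Ox HC; apply: (path_dist_lt bg g0 gM).
rewrite -lte_fin; apply: le_lt_trans HC.
apply: (@le_trans _ _ `|path_dist g x|%:E); first by rewrite lee_fin ler_norm.
apply: hardy => //; last by exists M.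
  split; last exact: (path_dist_out bg g0 gM).
  by exists (M * CQC); exact: path_dist_lip.
exact: path_dist_upper_gradient gM.
Qed.

End hardy_to_paths.

(** * Weighted averages and maximal functions *)

Section averages.
Context {R : realType} {d : measure_display} {X : metricMeasurableType R d}.
Variables (mu : {measure set X -> \bar R}) (w : X -> \bar R).
Hypotheses (borel_measurable : @borel R d X `<=` measurable)
  (bw : borel_fun w) (w0 : forall x, (0 <= w x)%E).
Local Notation W := (wmeasure mu w).
Local Open Scope ereal_scope.

Lemma borel_measurable_fun (f : X -> \bar R) : borel_fun f -> measurable_fun setT f.
Proof. by move=> bf _ B mB; rewrite setTI; apply: borel_measurable; exact: bf. Qed.

Definition wpower (q : R) (f : X -> \bar R) (y : X) := `|f y| `^ q * w y.

Lemma wpower_ge0 q f y : 0 <= wpower q f y.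
Proof. by rewrite mule_ge0// poweR_ge0. Qed.

Lemma measurable_wpower q f : borel_fun f -> measurable_fun setT (wpower q f).
Proof.
move=> bf; apply: emeasurable_funM; last exact: borel_measurable_fun.
apply: (measurableT_comp (measurable_poweR q)).
by apply: measurableT_comp => //; exact: borel_measurable_fun.
Qed.

Definition wint (q : R) (f : X -> \bar R) (A : set X) := \int[mu]_(y in A) wpower q f y.

Lemma wint_subset q f A B : borel_fun f -> measurable A -> measurable B ->
  A `<=` B -> wint q f A <= wint q f B.
Proof.
move=> bf mA mB AB; apply: ge0_subset_integral => //.
  by apply: measurable_funTS; exact: measurable_wpower.
by move=> x _; exact: wpower_ge0.
Qed.

Lemma wmeasure_subset A B : measurable A -> measurable B -> A `<=` B -> W A <= W B.
Proof.
move=> mA mB AB; apply: ge0_subset_integral => //.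
by apply: measurable_funTS; exact: borel_measurable_fun.
Qed.

Lemma average_le_poweR (a b : \bar R) (p t : R) : (0 < p)%R -> (0 <= t)%R ->
  0 < a < +oo -> 0 <= b ->
  (a^-1 * b) `^ p^-1 <= t%:E <-> b <= (t `^ p)%:E * a.
Proof.
move=> p0 t0 /andP[a0 aoo] b0.
have [a' a'0 ->] : exists2 a', (0 < a')%R & a = a'%:E.
  have aE : a = (fine a)%:E by rewrite fineK// ge0_fin_numE// ltW.
  by exists (fine a) => //; rewrite -lte_fin -aE.
rewrite inver gt_eqF//.
have ab0 : 0 <= (a'^-1)%:E * b by rewrite mule_ge0// lee_fin invr_ge0 ltW.
have pinv : (0 <= p^-1)%R by rewrite invr_ge0 ltW.
have -> : (b <= (t `^ p)%:E * a'%:E) <-> ((a'^-1)%:E * b <= (t `^ p)%:E).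
  by rewrite muleC lee_pdivrMl// muleC.
have tp : ((t `^ p) `^ p^-1 = t)%R by rewrite -powRrM mulfV ?gt_eqF// powRr1.
split=> H.
- have := @gt0_ler_poweR _ p (ltW p0) _ _ _ _ H.
  rewrite -poweRrM mulVf ?gt_eqF// poweRe1// poweR_EFin; apply.
    by rewrite in_itv/= poweR_ge0 leey.
  by rewrite in_itv/= lee_fin t0 leey.
- have := @gt0_ler_poweR _ p^-1 pinv _ _ _ _ H.
  rewrite poweR_EFin tp; apply; rewrite in_itv/= ?ab0 ?leey//.
  by rewrite lee_fin powR_ge0.
Qed.

Lemma sup_average_le (p rho t : R) f x : (0 < p)%R -> (0 <= t)%R ->
  (forall r, (0 < r < rho)%R -> 0 < W (ball x r) < +oo) ->
  sup_average mu p w rho f x <= t%:E <->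
  (forall r, (0 < r < rho)%R -> wint p f (ball x r) <= (t `^ p)%:E * W (ball x r)).
Proof.
move=> p0 t0 Wfin; split => [H r rrho|H].
  apply/(average_le_poweR p0 t0 (Wfin _ rrho)).
    by apply: integral_ge0 => y _; exact: wpower_ge0.
  by apply: le_trans H; apply: ereal_sup_ubound; right; exists r.
apply: ge_ereal_sup => _ [->|[r /= rrho <-]]; first by rewrite lee_fin.
apply/(average_le_poweR p0 t0 (Wfin _ rrho)) => //; last exact: H.
by apply: integral_ge0 => y _; exact: wpower_ge0.
Qed.


Lemma wpowerE q (g : X -> R) y : (0 <= g y)%R ->
  wpower q (EFin \o g) y = (g y `^ q)%:E * w y.
Proof. by move=> g0; rewrite /wpower /= ger0_norm. Qed.

Lemma powR_interpolation (p q t a : R) : (0 < p)%R -> (p <= q)%R ->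
  (0 < t)%R -> (0 <= a)%R -> (a `^ p <= t `^ p + t `^ (p - q) * a `^ q)%R.
Proof.
move=> p0 pq t0 a0; have [at_|ta] := leP a t.
  apply: ler_wpDr; first by rewrite mulr_ge0// powR_ge0.
  by rewrite ge0_ler_powR// ?nnegrE// ltW.
apply: ler_wpDl; first by rewrite powR_ge0.
have a0' : (0 < a)%R by exact: lt_trans ta.
have -> : (a `^ q = a `^ p * a `^ (q - p))%R.
  by rewrite -powRD ?(gt_eqF a0') ?implybT// [(p + _)%R]addrC subrK.
rewrite mulrCA -[leLHS]mulr1; apply: ler_wpM2l; first by rewrite powR_ge0.
have -> : (1 = t `^ (p - q) * t `^ (q - p))%R.
  by rewrite -powRD ?(gt_eqF t0) ?implybT// addrA subrK subrr powRr0.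
apply: ler_wpM2l; first by rewrite powR_ge0.
by rewrite ge0_ler_powR ?nnegrE ?subr_ge0// ltW.
Qed.

(** Since [g <= t] or [g^p <= t^p (g / t)^q], averages of the smaller power are
   controlled, up to the factor [2], by those of the larger one. *)
Lemma wint_le_exponent (p q t : R) (g : X -> R) A : (1 <= p)%R -> (p <= q)%R ->
  (0 < t)%R -> (forall x, 0 <= g x)%R -> borel_fun (EFin \o g) -> measurable A ->
  wint q (EFin \o g) A <= (t `^ q)%:E * W A ->
  wint p (EFin \o g) A <= ((2 * t) `^ p)%:E * W A.
Proof.
move=> p1 pq t0 g0 bg mA H; have p0 : (0 < p)%R by exact: lt_le_trans p1.
have mw : measurable_fun A w by apply: measurable_funTS; exact: borel_measurable_fun.
have mq : measurable_fun A (wpower q (EFin \o g)).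
  by apply: measurable_funTS; exact: measurable_wpower.
have W0 : 0 <= W A by exact: integral_ge0.
apply: (@le_trans _ _ (\int[mu]_(y in A)
    ((t `^ p)%:E * w y + (t `^ (p - q))%:E * wpower q (EFin \o g) y))).
  apply: ge0_le_integral => //.
  - by move=> y _; exact: wpower_ge0.
  - by apply: measurable_funTS; exact: measurable_wpower.
  - by apply: emeasurable_funD; apply: measurable_funeM.
  - move=> y _; rewrite !wpowerE// muleA -EFinM -ge0_muleDl ?lee_fin ?mulr_ge0 ?powR_ge0//.
    by apply: lee_wpmul2r => //; rewrite -EFinD lee_fin powR_interpolation.
rewrite ge0_integralD//; last 4 first.
- by move=> y _; rewrite mule_ge0// lee_fin powR_ge0.
- exact: measurable_funeM.
- by move=> y _; rewrite mule_ge0 ?wpower_ge0// lee_fin powR_ge0.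
- exact: measurable_funeM.
rewrite !ge0_integralZl_EFin ?powR_ge0//; last by move=> y _; exact: wpower_ge0.
apply: (@le_trans _ _ ((t `^ p)%:E * W A + (t `^ (p - q))%:E * ((t `^ q)%:E * W A))).
  apply: leeD => //; apply: lee_wpmul2l => //.
  by rewrite lee_fin powR_ge0.
rewrite muleA -EFinM -powRD ?(gt_eqF t0) ?implybT// subrK.
rewrite -ge0_muleDl ?lee_fin ?powR_ge0//; apply: lee_wpmul2r => //.
rewrite -EFinD lee_fin powRM ?(ltW t0)// -mulr2n -[leLHS]mulr_natl.
rewrite ler_wpM2r ?powR_ge0//.
by rewrite -[leLHS]powRr1// ler_powR// ler1n.
Qed.

End averages.

(** * Weak type estimates for superlevel sets *)

Section weak_type.
Context {R : realType} {d : measure_display} {X : metricMeasurableType R d}.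
Variables (mu : {measure set X -> \bar R}) (w : X -> \bar R) (Omega : set X).
Hypotheses (borel_measurable : @borel R d X `<=` measurable) (mu_doubling : doubling mu)
  (bw : borel_fun w) (w0 : forall x, (0 <= w x)%E).
Local Notation W := (wmeasure mu w).
Local Notation rho x := (mdist_set x (~` Omega)).
Variables (kappa C : R) (C1 : 1 <= C).
Hypothesis w_doubling : forall x r, Omega x -> 0 < r <= 8 * kappa * rho x ->
  (0 < W (ball x r) < +oo)%E /\ (W (ball x r) <= C%:E * W (ball x (r / 2)))%E.
Implicit Types (x y z : X) (g : X -> R).

(** Balls with center in [Omega] over which the average of [g^q] exceeds [t^q];
   [r0] truncates the radii. Their union is the superlevel set of an uncentered
   maximal function, hence open. *)
Definition bad_balls (q : R) g (r0 t : R) : set (X * R) :=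
  [set p | [/\ Omega p.1, 0 < p.2, p.2 < kappa * rho p.1, p.2 < r0 &
   ((t `^ q)%:E * W (ball p.1 p.2) < wint mu w q (EFin \o g) (ball p.1 p.2))%E]].

Definition bad_set q g r0 t : set X := \bigcup_(p in bad_balls q g r0 t) ball p.1 p.2.

Lemma bad_set_open q g r0 t : open (bad_set q g r0 t).
Proof. by apply: bigcup_open => p _; exact: metric_ball_open. Qed.

Lemma notin_bad_set q g r0 t x r : ~ bad_set q g r0 t x -> Omega x ->
  0 < r -> r < kappa * rho x -> r < r0 ->
  (wint mu w q (EFin \o g) (ball x r) <= (t `^ q)%:E * W (ball x r))%E.
Proof.
move=> xE Ox rp rk rr0; rewrite leNgt; apply/negP => H; apply: xE.
exists (x, r); first by split.
by rewrite /= ballEmdist /= mdistxx.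
Qed.

Lemma w_doubling_iter n x r : Omega x -> 0 < r -> 2 ^+ n * r <= 8 * kappa * rho x ->
  (W (ball x (2 ^+ n * r)) <= (C ^+ n)%:E * W (ball x r))%E.
Proof.
move=> Ox r0; elim: n => [|n IH]; first by rewrite !expr0 mul1r mul1e.
have t0 : 0 < 2 ^+ n * r by rewrite mulr_gt0// exprn_gt0.
rewrite !exprS -mulrA => H.
have [|_ /le_trans] := w_doubling (r := 2 * (2 ^+ n * r)) Ox.
  by rewrite mulr_gt0.
apply; rewrite [2 * _]mulrC mulfK// EFinM -muleA lee_pmul2l//; last first.
  by rewrite lte_fin (lt_le_trans _ C1).
by apply: IH; lra.
Qed.

Let C0 : 0 <= C. Proof. by rewrite (le_trans _ C1). Qed.

Variables (q tau : R) (g : X -> R).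
Hypothesis bg : borel_fun (EFin \o g).
Local Notation G := (wint mu w q (EFin \o g)).

Section at_a_point.
Variables (x : X) (t : R).
Hypotheses (Ox : Omega x) (t0 : 0 < t)
  (Hx : forall r, 0 < r < kappa * rho x -> (G (ball x r) <= (tau `^ q)%:E * W (ball x r))%E)
  (t_large : C ^+ 3 * tau `^ q <= t `^ q).
Local Notation r0 := (kappa * rho x / 4).

(** A bad ball meeting [ball x p.2] would be comparable with a ball centered at
   [x], over which the average is at most [tau^q]; for [t] large against [tau]
   this contradicts its badness. *)
Lemma bad_ball_disjoint p : bad_balls q g r0 t p ->
  ball p.1 p.2 `&` ball x p.2 = set0.
Proof.
case: p => y s [/= Oy s0 sy sx bad]; apply/seteqP; split => // z [].
rewrite !ballEmdist /= => yz xz.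
have xy : mdist x y < 2 * s.
  by have := metric_triangle x z y; rewrite (metric_sym z y); lra.
have B1 : ball y s `<=` ball x (3 * s) by apply: ball_subset; lra.
have B2 : ball x (3 * s) `<=` ball y (2 ^+ 3 * s).
  by apply: ball_subset; rewrite metric_sym -natrX; lra.
have mb := measurable_ball borel_measurable.
move: bad; rewrite ltNge => /negP; apply.
apply: le_trans (wint_subset mu borel_measurable bw w0 q bg (mb _ _) (mb _ _) B1) _.
apply: le_trans (Hx _) _; first by apply/andP; split; lra.
apply: (@le_trans _ _ ((tau `^ q)%:E * ((C ^+ 3)%:E * W (ball y s)))%E).
  apply: lee_wpmul2l; first by rewrite lee_fin powR_ge0.
  apply: le_trans (wmeasure_subset mu borel_measurable bw w0 (mb _ _) (mb _ _) B2) _.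
  by apply: w_doubling_iter => //; rewrite -natrX; lra.
rewrite muleA -EFinM mulrC; apply: lee_wpmul2r; first exact: integral_ge0.
by rewrite lee_fin.
Qed.

Lemma notin_bad_set_center : ~ bad_set q g r0 t x.
Proof.
move=> [[y s] bad /= yx]; have := bad_ball_disjoint bad.
have s0 : 0 < s by case: bad.
move=> /seteqP[/(_ x) + _]; apply; split => //=.
by rewrite ballEmdist /= mdistxx.
Qed.

(** Only bad balls of radius less than [r] meet [ball x r], and these lie in
   [ball x (3 * r)], where the average of [g^q] is at most [tau^q]. *)
Lemma weak_type r : 0 < r -> 3 * r < kappa * rho x ->
  (W (bad_set q g r0 t `&` ball x r) <=
     (C ^+ 5 * (tau `^ q / t `^ q))%:E * W (ball x r))%E.
Proof.
move=> rp r3.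
have mb := measurable_ball borel_measurable.
have [Wm WmE] := integral_measure_ex mu w0 (borel_measurable_fun borel_measurable bw).
have [Gm GmE] := integral_measure_ex mu (wpower_ge0 w0 q (EFin \o g))
  (measurable_wpower borel_measurable bw q bg).
pose F := [set p | bad_balls q g r0 t p /\ ball p.1 p.2 `&` ball x r !=set0].
have Fr p : F p -> p.2 < r.
  move=> [bad [z [pz xz]]]; rewrite ltNge; apply/negP => rs.
  have := bad_ball_disjoint bad => /seteqP[/(_ z) + _]; apply; split => //.
  by move: xz; rewrite !ballEmdist /= => /lt_le_trans; apply.
have FE : bad_set q g r0 t `&` ball x r `<=` \bigcup_(p in F) ball p.1 p.2.
  by move=> z [[p bad pz] xz]; exists p => //; split => //; exists z.
apply: (@le_trans _ _ (Wm (\bigcup_(p in F) ball p.1 p.2))).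
  rewrite WmE; apply: wmeasure_subset => //.
    apply: measurableI => //; apply: borel_measurable.
    by apply: sub_sigma_algebra; exact: bad_set_open.
  apply: borel_measurable; apply: sub_sigma_algebra.
  by apply: bigcup_open => p _; exact: metric_ball_open.
have tq0 : 0 < t `^ q by exact: powR_gt0.
have C30 : 0 <= C ^+ 3 by exact: exprn_ge0.
have := @vitali_measure_le R d X mu borel_measurable mu_doubling Wm Gm F x (3 * r)
  (C ^+ 3) ((t `^ q)^-1) C30.
move=> /(_ _ _ _ _ _)/le_trans; apply.
- by rewrite invr_ge0 ltW.
- move=> p Fp; have [[Oy s0 _ _ _] [z [pz xz]]] := Fp; split => //.
  apply: ball_subset; have := Fr _ Fp; move: pz xz; rewrite !ballEmdist /=.
  by have := metric_triangle x z p.1; rewrite (metric_sym z p.1); lra.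
- by exists r => p /Fr/ltW.
- move=> p [[Oy s0 sy _ _] _]; rewrite !WmE.
  apply: le_trans (wmeasure_subset mu borel_measurable bw w0 (mb _ _) (mb p.1 (2 ^+ 3 * p.2)) _) _.
    by apply: ball_subset; rewrite mdistxx -natrX; lra.
  by apply: w_doubling_iter => //; rewrite -natrX; lra.
- move=> p [[Oy s0 sy _ bad] _]; rewrite WmE GmE lee_pdivlMl//.
  exact: ltW.
rewrite GmE.
apply: (@le_trans _ _ ((C ^+ 3 / t `^ q)%:E * ((tau `^ q)%:E * ((C ^+ 2)%:E * W (ball x r))))%E).
  apply: lee_wpmul2l; first by rewrite lee_fin divr_ge0// ltW.
  apply: le_trans (Hx _) _; first by apply/andP; split; lra.
  apply: lee_wpmul2l; first by rewrite lee_fin powR_ge0.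
  apply: le_trans (wmeasure_subset mu borel_measurable bw w0 (mb _ _) (mb x (2 ^+ 2 * r)) _) _.
    by apply: ball_subset; rewrite mdistxx -natrX; lra.
  by apply: w_doubling_iter => //; rewrite -natrX; lra.
rewrite !muleA -!EFinM; apply: lee_wpmul2r; first exact: integral_ge0.
rewrite lee_fin le_eqVlt; apply/orP; left; apply/eqP; ring.
Qed.

End at_a_point.
End weak_type.

(** * Sums over levels *)

Section level_sums.
Context {R : realType}.

(** The largest level present dominates the geometric sum, so that taking the
   power [p] costs a factor independent of the number [k] of levels. *)
Lemma powR_level_sum_le (M p : R) (b : nat -> bool) k : 2 <= M -> 1 <= p ->
  (1 + \sum_(j < k) M ^+ j.+1 * (b j)%:R) `^ p <=
  4 `^ p * (1 + \sum_(j < k) (M ^+ j.+1) `^ p * (b j)%:R).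
Proof.
move=> M2 p1; have p0 : 0 <= p by lra.
have M0 : 0 <= M by lra.
have S0 n : 0 <= \sum_(j < n) M ^+ j.+1 * (b j)%:R.
  by apply: sumr_ge0 => j _; rewrite mulr_ge0// exprn_ge0.
have T0 n : 0 <= \sum_(j < n) (M ^+ j.+1) `^ p * (b j)%:R.
  by apply: sumr_ge0 => j _; rewrite mulr_ge0// powR_ge0.
have SM n : \sum_(j < n) M ^+ j.+1 * (b j)%:R <= 2 * M ^+ n.
  elim: n => [|n IH]; first by rewrite big_ord0 expr0; lra.
  rewrite big_ord_recr /= exprS.
  have Mn0 : 0 <= M ^+ n by exact: exprn_ge0.
  have : M * M ^+ n * (b n)%:R <= M * M ^+ n.
    by rewrite ler_piMr ?mulr_ge0//; case: (b n).
  have : 2 * M ^+ n <= M * M ^+ n by rewrite ler_wpM2r.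
  by lra.
elim: k => [|k IH].
  rewrite !big_ord0 !addr0 mulr1 powR1.
  by rewrite -[leLHS](powRr0 4) ler_powR// ler1n.
rewrite !big_ord_recr /=; case bk : (b k); last by rewrite !mulr0 !addr0.
rewrite !mulr1.
have M1 : 1 <= M ^+ k.+1 by apply: exprn_ege1; lra.
apply: (@le_trans _ _ ((4 * M ^+ k.+1) `^ p)).
  apply: ge0_ler_powR => //; rewrite ?nnegrE.
  - by rewrite addr_ge0 ?ler01// addr_ge0 ?S0 ?exprn_ge0.
  - by rewrite mulr_ge0// exprn_ge0.
  have := SM k; have : 2 * M ^+ k <= M ^+ k.+1.
    by rewrite exprS ler_wpM2r// exprn_ge0.
  by lra.
rewrite powRM ?exprn_ge0//; apply: ler_wpM2l; first exact: powR_ge0.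
by have := T0 k; lra.
Qed.

Lemma lee_sum_cst k (F : 'I_k -> \bar R) (c : R) (a : \bar R) : 0 <= c ->
  (0 <= a)%E -> (forall j, F j <= c%:E * a)%E ->
  (\sum_(j < k) F j <= (k%:R * c)%:E * a)%E.
Proof.
move=> c0 a0 Fc; apply: (@le_trans _ _ (\sum_(j < k) (c%:E * a))%E).
  by apply: lee_sum => j _.
elim: k {F Fc} => [|k IH]; first by rewrite big_ord0 mul0r mul0e.
rewrite big_ord_recr /= -natr1 mulrDl mul1r EFinD ge0_muleDl ?lee_fin ?mulr_ge0//.
exact: leeD.
Qed.

(** The number of levels: [k^(1/p)] grows more slowly than [k]. *)
Lemma level_count_ex (K e p : R) : 1 < p -> 0 <= K -> 0 < e ->
  exists2 k : nat, (0 < k)%N & (K * k%:R) `^ p^-1 <= e * k%:R.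
Proof.
move=> p1 K0 e0; have p0 : 0 < p by lra.
have p10 : 0 < p - 1 by lra.
pose a := (K / e `^ p) `^ (p - 1)^-1.
exists (Num.truncn a).+1 => //; set k := (X in X%:R).
have k0 : 0 < k%:R :> R by rewrite ltr0n.
have ek : 0 <= e * k%:R by rewrite mulr_ge0// ltW.
have ep0 : 0 < e `^ p by exact: powR_gt0.
have -> : e * k%:R = ((e * k%:R) `^ p) `^ p^-1.
  by rewrite -powRrM mulfV ?gt_eqF// powRr1.
apply: ge0_ler_powR; rewrite ?nnegrE ?powR_ge0 ?invr_ge0 ?(ltW p0)//.
  by rewrite mulr_ge0// ltW.
rewrite powRM ?(ltW e0) ?(ltW k0)//.
have -> : (k%:R : R) `^ p = (k%:R : R) `^ (p - 1) * k%:R.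
  by rewrite -[X in _ * X]powRr1 ?(ltW k0)// -powRD ?(gt_eqF k0) ?implybT// subrK.
rewrite mulrA ler_pM2r// -ler_pdivrMl// mulrC.
have -> : K / e `^ p = a `^ (p - 1).
  rewrite /a -powRrM mulVf ?gt_eqF// powRr1//.
  by rewrite divr_ge0// ltW.
apply: ge0_ler_powR; rewrite ?nnegrE ?powR_ge0 ?(ltW p10) ?(ltW k0)//.
exact/ltW/truncnS_gt.
Qed.

(** How close [q] must be to [p] for [a^(p-q)], which is the loss over all
   levels, to be harmless. *)
Lemma exponent_ex (a p0 p : R) : 1 < a -> p0 < p ->
  exists q, p0 < q < p /\ a `^ (p - q) <= 2.
Proof.
move=> a1 pp; have la : 0 < ln a by rewrite ln_gt0.
have l2 : 0 < ln 2 :> R by rewrite ln_gt0// ltr1n.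
pose s := Num.min ((p - p0) / 2) (ln 2 / ln a).
have s0 : 0 < s by rewrite lt_min !divr_gt0// subr_gt0.
have s1 : s <= (p - p0) / 2 by rewrite ge_min lexx.
have s2 : s <= ln 2 / ln a by rewrite ge_min lexx orbT.
exists (p - s); split; first by apply/andP; split; lra.
rewrite opprB addrC subrK /powR gt_eqF; last lra.
rewrite -[leRHS]lnK ?posrE// ler_expR.
by rewrite -ler_pdivlMr.
Qed.

End level_sums.

(** * A level met in a short set, and chains avoiding it *)

Section small_bad_set.
Context {R : realType} {d : measure_display} {X : metricMeasurableType R d}.
Variables (mu : {measure set X -> \bar R}) (w : X -> \bar R) (Omega : set X).
Hypotheses (borel_measurable : @borel R d X `<=` measurable) (mu_doubling : doubling mu)
  (bw : borel_fun w) (w0 : forall x, (0 <= w x)%E).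
Local Notation W := (wmeasure mu w).
Local Notation rho x := (mdist_set x (~` Omega)).
Variables (kappa C : R) (C1 : 1 <= C).
Hypothesis w_doubling : forall x r, Omega x -> 0 < r <= 8 * kappa * rho x ->
  (0 < W (ball x r) < +oo)%E /\ (W (ball x r) <= C%:E * W (ball x (r / 2)))%E.
Implicit Types (x y z : X) (g : X -> R).
Local Notation leb := (@lebesgue_measure R).
Local Notation mR := (measurableTypeR R).

Variables (M q p : R) (k : nat).
Hypotheses (M2 : 2 <= M) (MC : C ^+ 3 <= M) (q1 : 1 <= q) (qp : q <= p)
  (k0 : (0 < k)%N) (Mkpq : (M ^+ k) `^ (p - q) <= 2).

Let M0 : 0 <= M. Proof. exact: le_trans M2. Qed.
Let M_ge1 : 1 <= M. Proof. by apply: le_trans M2; rewrite ler1n. Qed.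

Section levels.
Variables (E : nat -> set X).
Hypothesis Eo : forall j, open (E j).

(** The weight [M^(j+1)] of a level compensates for the smallness of its
   superlevel set. The summand [1] makes costs of paths bound their lengths. *)
Definition level_sum (y : X) : R := 1 + \sum_(j < k) M ^+ j.+1 * \1_(E j) y.

Let ME j : 0 <= M ^+ j. Proof. exact: exprn_ge0. Qed.

Lemma level_sum_ge0 y : 0 <= level_sum y.
Proof. by rewrite addr_ge0// sumr_ge0// => j _; rewrite mulr_ge0// ME. Qed.

Lemma level_sum_bound y : level_sum y <= 1 + \sum_(j < k) M ^+ j.+1.
Proof.
rewrite lerD2l; apply: ler_sum => j _.
by rewrite ler_piMr ?ME// indicE; case: (_ \in _).
Qed.

Lemma borel_level_sum : borel_fun (EFin \o level_sum).
Proof.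
apply/borel_funP; apply/measurable_EFinP.
apply: measurable_funD => //.
have -> : (fun y => \sum_(j < k) M ^+ j.+1 * \1_(E j) y) =
   (fun y : g_sigma_algebraType (@open X) => \sum_(j < k) (M ^+ j.+1 * \1_(E j) y)) by [].
apply: measurable_sum => j; apply: measurable_funM => //.
apply: measurable_indic; apply: sub_sigma_algebra; exact: Eo.
Qed.

Lemma path_cost_level_sum (L : R) (c : R -> X) : lip1 c -> 0 <= L ->
  path_cost (EFin \o level_sum) L c =
  (L%:E + \sum_(j < k) (M ^+ j.+1)%:E * leb ([set s | E j (c s)] `&` `[0%R, L]))%E.
Proof.
move=> lc L0; rewrite /path_cost.
have mE j : measurable ([set s | E j (c s)] : set mR).
  apply: open_measurable.
  by move/continuousP: (lip1_continuous lc); exact.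
rewrite (eq_integral (fun s : mR => 1%E +
    \sum_(j < k) (M ^+ j.+1)%:E * (\1_[set s | E j (c s)] s)%:E)%E); last first.
  move=> s _; rewrite /= /level_sum EFinD -sumEFin; congr (_ + _)%E.
have mi j : measurable_fun `[0, L]
    (fun s : mR => ((M ^+ j.+1)%:E * (\1_[set s | E j (c s)] s)%:E)%E).
  apply: measurable_funeM; apply/measurable_EFinP.
  by apply: measurable_indic; exact: mE.
have i0 j (s : mR) : (0 <= (M ^+ j.+1)%:E * (\1_[set s | E j (c s)] s)%:E)%E.
  by rewrite mule_ge0// lee_fin.
rewrite ge0_integralD//; last 2 first.
- by move=> s _; exact: sume_ge0.
- by apply: emeasurable_sum => j; exact: mi.
congr (_ + _)%E.
  rewrite integral_cst//= mul1e lebesgue_measure_itv/= lte_fin.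
  case: ltP => // [_|L0']; first by rewrite oppr0 adde0.
  by congr (_%:E); apply/eqP; rewrite eq_le L0 L0'.
rewrite ge0_integral_sum//; last by move=> j; exact: mi.
apply: eq_bigr => j _.
rewrite ge0_integralZl_EFin//.
- by rewrite integral_indic.
- by apply/measurable_EFinP; apply: measurable_indic; exact: mE.
Qed.

End levels.

Variables (g : X -> R) (bg : borel_fun (EFin \o g)).
Local Notation G := (wint mu w q (EFin \o g)).
Variables (x : X) (tau : R).
Hypotheses (Ox : Omega x) (tau0 : 0 < tau)
  (Hx : forall r, 0 < r < kappa * rho x -> (G (ball x r) <= (tau `^ q)%:E * W (ball x r))%E).

(** The superlevel sets at heights [M^(j+1) * tau]. Radii are truncated at
   [kappa * rho x / 4] so that bad balls are comparable with balls centered at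
   [x] of radius less than [kappa * rho x]. *)
Definition level_set (j : nat) : set X :=
  bad_set mu w Omega kappa q g (kappa * rho x / 4) (M ^+ j.+1 * tau).

Let M1 j : 1 <= M ^+ j. Proof. exact: exprn_ege1. Qed.
Let p1 : 1 <= p. Proof. exact: le_trans q1 qp. Qed.
Let Mtau0 j : 0 < M ^+ j * tau. Proof. by rewrite mulr_gt0// (lt_le_trans _ (M1 j)). Qed.
Let C5 : 1 <= C ^+ 5. Proof. exact: exprn_ege1. Qed.

Let t_large j : C ^+ 3 * tau `^ q <= (M ^+ j.+1 * tau) `^ q.
Proof.
have Mj := M1 j.+1.
rewrite powRM ?(ltW tau0) ?(le_trans _ Mj)//; apply: ler_wpM2r; first exact: powR_ge0.
apply: (le_trans MC); apply: (@le_trans _ _ (M ^+ j.+1)).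
  by rewrite exprS ler_peMr ?M1.
by rewrite -[leLHS]powRr1 ?(le_trans _ Mj)// ler_powR.
Qed.

Lemma level_set_open j : open (level_set j). Proof. exact: bad_set_open. Qed.

Lemma notin_level_set_center j : ~ level_set j x.
Proof. exact: (notin_bad_set_center borel_measurable bw w0 C1 w_doubling bg Hx (t_large j)). Qed.

(** The level [j] contributes [M^((j+1)(p-q))] to the average of [level_sum^p]; this
   factor is at most [2] since [q] is close to [p]. *)
Lemma level_set_weak_type (j : 'I_k) r : 0 < r -> 3 * r < kappa * rho x ->
  (((M ^+ j.+1) `^ p)%:E * W (level_set j `&` ball x r) <= (2 * C ^+ 5)%:E * W (ball x r))%E.
Proof.
move=> r0 r3; have Mj := M1 j.+1; have Mj0 : 0 < M ^+ j.+1 by lra.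
have := weak_type borel_measurable mu_doubling bw w0 C1 w_doubling
  bg Ox (Mtau0 j.+1) Hx (t_large j) r0 r3.
move=> /(lee_wpmul2l _) -/(_ ((M ^+ j.+1) `^ p)%:E).
rewrite lee_fin powR_ge0 => /(_ isT) /le_trans; apply.
rewrite muleA -EFinM; apply: lee_wpmul2r; first exact: integral_ge0.
rewrite lee_fin.
have -> : tau `^ q / (M ^+ j.+1 * tau) `^ q = ((M ^+ j.+1) `^ q)^-1.
  rewrite powRM ?(ltW tau0) ?(ltW Mj0)// invfM mulrCA mulfV ?mulr1//.
  by rewrite gt_eqF// powR_gt0.
rewrite mulrCA mulrC; apply: ler_wpM2r; first by rewrite (le_trans _ C5).
rewrite -powRN -powRD ?(gt_eqF Mj0) ?implybT//.
apply: le_trans Mkpq; apply: ge0_ler_powR; rewrite ?nnegrE ?(ltW Mj0)//; first by rewrite subr_ge0.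
  by rewrite exprn_ge0.
by rewrite ler_weXn2l.
Qed.

Lemma wint_level_sum r : 0 < r -> 3 * r < kappa * rho x ->
  (wint mu w p (EFin \o level_sum level_set) (ball x r) <=
     (4 `^ p * (1 + k%:R * (2 * C ^+ 5)))%:E * W (ball x r))%E.
Proof.
move=> r0 r3.
have mb := measurable_ball borel_measurable.
have mE j : measurable (level_set j).
  by apply: borel_measurable; apply: sub_sigma_algebra; exact: level_set_open.
have mw : measurable_fun setT w by exact: borel_measurable_fun.
pose T (y : X) : \bar R :=
  (w y + \sum_(j < k) ((M ^+ j.+1) `^ p)%:E * (w \_ (level_set j)) y)%E.
have wE0 j y : (0 <= (w \_ (level_set j)) y)%E by rewrite patchE; case: ifP.
have mwE j : measurable_fun setT (w \_ (level_set j)).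
  by apply/(measurable_restrictT _ (mE j)).1; exact: measurable_funTS.
have mt (j : 'I_k) : measurable_fun setT
    (fun y => ((M ^+ j.+1) `^ p)%:E * (w \_ (level_set j)) y)%E.
  exact: measurable_funeM.
have t0 (j : 'I_k) y : (0 <= ((M ^+ j.+1) `^ p)%:E * (w \_ (level_set j)) y)%E.
  by rewrite mule_ge0// lee_fin powR_ge0.
have mS : measurable_fun setT
    (fun y => \sum_(j < k) ((M ^+ j.+1) `^ p)%:E * (w \_ (level_set j)) y)%E.
  by apply: emeasurable_sum => j; exact: mt.
have S0 y : (0 <= \sum_(j < k) ((M ^+ j.+1) `^ p)%:E * (w \_ (level_set j)) y)%E.
  exact: sume_ge0.
have T0 y : (0 <= T y)%E by exact: adde_ge0.
have mT : measurable_fun setT T by exact: emeasurable_funD.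
apply: (@le_trans _ _ (\int[mu]_(y in ball x r) ((4 `^ p)%:E * T y))%E).
  apply: ge0_le_integral => //.
  - by move=> y _; exact: wpower_ge0.
  - apply: measurable_funTS; apply: measurable_wpower => //.
    exact: borel_level_sum level_set_open.
  - by apply: measurable_funTS; exact: measurable_funeM.
  move=> y _; rewrite wpowerE ?level_sum_ge0//.
  have -> : T y = ((1 + \sum_(j < k) (M ^+ j.+1) `^ p * (y \in level_set j)%:R)%:E * w y)%E.
    rewrite EFinD ge0_muleDl ?lee_fin ?sumr_ge0// ?mul1e; last first.
      by move=> j _; rewrite mulr_ge0// powR_ge0.
    congr (_ + _)%E; rewrite -sumEFin ge0_sume_distrl; last first.
      by move=> j _; rewrite lee_fin mulr_ge0// powR_ge0.
    apply: eq_bigr => j _; rewrite EFinM -muleA patchE.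
    by case: ifP => _; rewrite ?mul1e ?mul0e.
  rewrite muleA -EFinM; apply: lee_wpmul2r => //; rewrite lee_fin.
  exact: (powR_level_sum_le (fun j => y \in level_set j) k M2 p1).
rewrite ge0_integralZl_EFin ?powR_ge0//; last exact: measurable_funTS.
rewrite EFinM -muleA; apply: lee_wpmul2l; first by rewrite lee_fin powR_ge0.
rewrite ge0_integralD//; last 2 first.
- exact: measurable_funTS.
- exact: measurable_funTS.
have W0 A : (0 <= W A)%E by exact: integral_ge0.
have C50 : 0 <= 2 * C ^+ 5 by rewrite mulr_ge0// (le_trans _ C5).
have -> : ((1 + k%:R * (2 * C ^+ 5))%:E * W (ball x r) =
    W (ball x r) + (k%:R * (2 * C ^+ 5))%:E * W (ball x r))%E.
  have kC0 : 0 <= k%:R * (2 * C ^+ 5) by exact: mulr_ge0.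
  by rewrite EFinD ge0_muleDl ?lee_fin// mul1e.
apply: leeD => //.
rewrite ge0_integral_sum//; last by move=> j; exact: measurable_funTS.
apply: lee_sum_cst => // j.
rewrite ge0_integralZl_EFin ?powR_ge0//; last exact: measurable_funTS.
rewrite -integral_mkcondr setIC.
exact: level_set_weak_type.
Qed.

(** Pigeonhole: the total cost of the [k] levels is at most [B], so that some
   level costs at most [B / k]. For the path given by the Hardy inequality, [B] is
   of order [k^(1/p)], and [1 < p] makes [B / k] small. *)
Lemma short_level_ex (L B : R) (c : R -> X) : lip1 c -> 0 <= L -> 0 <= B ->
  (path_cost (EFin \o level_sum level_set) L c <= B%:E)%E ->
  L <= B /\ exists j : 'I_k,
    (leb ([set s | level_set j (c s)] `&` `[0%R, L]) <= (B / k%:R / M ^+ j.+1)%:E)%E.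
Proof.
move=> lc L0 B0; rewrite (path_cost_level_sum level_set_open lc L0).
set F := fun j : 'I_k => ((M ^+ j.+1)%:E * leb ([set s | level_set j (c s)] `&` `[0%R, L]))%E.
have F0 j : (0 <= F j)%E by rewrite mule_ge0// lee_fin exprn_ge0.
have S0 : (0 <= \sum_(j < k) F j)%E by exact: sume_ge0.
move=> H; split; first by rewrite -lee_fin; apply: le_trans H; exact: leeDl.
apply: contrapT => nj.
have kR0 : 0 < k%:R :> R by rewrite ltr0n.
have Fj j : ((B / k%:R)%:E < F j)%E.
  rewrite ltNge; apply/negP => HF; apply: nj; exists j.
  have Mj : 0 < M ^+ j.+1 by exact: lt_le_trans (M1 j.+1).
  by rewrite [(_ / M ^+ j.+1)%R]mulrC EFinM lee_pdivlMl.
have {}H : (\sum_(j < k) F j <= B%:E)%E.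
  by apply: le_trans H; apply: leeDr; rewrite lee_fin.
have : (\sum_(j < k) (B / k%:R)%:E < \sum_(j < k) F j)%E.
  have Ffin j : F j \is a fin_num.
    rewrite ge0_fin_numE//; apply: le_lt_trans (ltry B); apply: le_trans H.
    by rewrite (bigD1 j)//= leeDl// sume_ge0.
  have FE j : F j = (fine (F j))%:E by rewrite fineK.
  under [X in (_ < X)%E]eq_bigr do rewrite FE.
  rewrite !sumEFin lte_fin; apply: ltr_sum => [|j _].
    by apply/hasP; exists (Ordinal k0) => //; exact: mem_index_enum.
  by rewrite -lte_fin -FE.
move=> /lt_le_trans/(_ H); rewrite sumEFin sumr_const card_ord lte_fin.
by rewrite -[_ *+ k]mulr_natr divfK ?gt_eqF// ltxx.
Qed.

End small_bad_set.

Section chaining.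
Context {R : realType} {d : measure_display} {X : metricMeasurableType R d}.
Variables (Omega : set X).
Local Notation rho x := (mdist_set x (~` Omega)).
Local Notation leb := (@lebesgue_measure R).

(** Following [c], one jumps between points outside [E]: as [E] meets [c] in a
   set of length less than [eta / 2], there is such a point at parameter distance
   between [eta / 2] and [eta], unless the complement of [Omega] is near. *)
Lemma chain_to_boundary (g : X -> \bar R) (E : set X) (c : R -> X)
    (L K eta sigma : R) : borel_fun g -> (forall x, 0 <= g x)%E ->
  open E -> lip1 c -> 0 <= L -> (~` Omega) (c L) -> Omega (c 0) -> ~ E (c 0) ->
  0 < eta -> eta <= sigma -> 0 <= K ->
  (leb ([set s | E (c s)] `&` `[0%R, L]) < (eta / 2)%:E)%E ->
  (forall y z, Omega y -> Omega z -> ~ E y -> ~ E z -> sigma < rho y ->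
     mdist y z <= eta -> joins g y [set z] (K * eta)) ->
  exists y, [/\ Omega y, ~ E y, rho y <= sigma & joins g (c 0) [set y] (2 * K * L)].
Proof.
move=> bg g0 oE lc L0 cL c0O c0E eta0 es K0 small step.
suff [s [sL sO sE sj ss]] : exists s, [/\ 0 <= s <= L, Omega (c s), ~ E (c s),
    joins g (c 0) [set c s] (2 * K * s) & rho (c s) <= sigma].
  exists (c s); split => //; apply: joins_le sj.
  by apply: ler_wpM2l; [lra|case/andP: sL].
apply: contrapT => none.
have H n : exists s, [/\ 0 <= s <= L, Omega (c s), ~ E (c s),
    joins g (c 0) [set c s] (2 * K * s) & n%:R * (eta / 2) <= s].
  elim: n => [|n [s [/andP[s0 sL] sO sE sj ns]]].
    exists 0; split => //; first by rewrite lexx.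
      by rewrite mulr0; exact: joins_refl.
    by rewrite mul0r.
  have sig : sigma < rho (c s).
    rewrite ltNge; apply/negP => H; apply: none.
    by exists s; rewrite s0 sL.
  have rL : rho (c s) <= L - s.
    apply: le_trans (mdist_set_le _ cL) _.
    by apply: le_trans (lc _ _) _; rewrite ler0_norm ?subr_le0//; lra.
  have [s' s's s'E] : exists2 s', s + eta / 2 <= s' <= s + eta & ~ E (c s').
    apply: contrapT => noE; move: small; rewrite ltNge => /negP; apply.
    apply: (@le_trans _ _ (leb `[s + eta / 2, s + eta])).
      rewrite [leRHS](lebesgue_measure_itv `[s + eta / 2, s + eta]) /= lte_fin.
      by case: ltP; rewrite -?EFinB lee_fin; lra.
    apply: le_measure; rewrite ?inE.
    - exact: measurable_itv.
    - apply: measurableI => //; apply: open_measurable.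
      by move/continuousP: (lip1_continuous lc); exact.
    move=> t /=; rewrite !in_itv/= => ts; split; last lra.
    by apply: contrapT => tE; apply: noE; exists t.
  have ss' : mdist (c s) (c s') <= eta.
    by apply: le_trans (lc _ _) _; rewrite ler0_norm; lra.
  have s'O : Omega (c s').
    by apply: (@mdist_setC_lt _ _ _ _ (c s)); lra.
  exists s'; split => //; first lra.
    apply: joins_le (joins_trans bg g0 sj (step _ _ sO s'O sE s'E sig ss')).
    have : K * (s' - s) >= K * (eta / 2) by apply: ler_wpM2l => //; lra.
    by lra.
  by rewrite -natr1; lra.
have e2 : 0 < eta / 2 by lra.
have [s [/andP[_ sL] _ _ _]] := H (Num.truncn (L / (eta / 2))).+1.
have := truncnS_gt (L / (eta / 2)); rewrite ltr_pdivrMr// => H1 H2.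
by have := lt_le_trans H1 H2; lra.
Qed.

End chaining.

(** * Self-improvement for paths *)

Section self_improvement.
Context {R : realType} {d : measure_display} {X : metricMeasurableType R d}.
Implicit Types (x y z : X) (g : X -> R).

Lemma lower_semicontinuous_borel (f : X -> \bar R) :
  lower_semicontinuous f -> borel_fun f.
Proof.
move=> lf; apply/borel_funP; apply: (measurability _ (ErealGenOInfty.measurableE R)).
move=> /= _ [_ [a ->]] <-; rewrite setTI preimage_itvoy.
by apply: sub_sigma_algebra; move/lower_semicontinuousP : lf; exact.
Qed.

Variables (mu : {measure set X -> \bar R}) (CQC : R) (Omega : set X) (w : X -> \bar R).
Hypotheses (borel_measurable : @borel R d X `<=` measurable)
  (CQC1 : 1 <= CQC) (qc : quasiconvex X CQC)
  (Omega_open : open Omega) (Omega_proper : ~` Omega !=set0)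
  (bw : borel_fun w) (w0 : forall x, (0 <= w x)%E).
Local Notation W := (wmeasure mu w).
Local Notation rho x := (mdist_set x (~` Omega)).

(** Off the bad set, the maximal functions on the right of the Poincare
   inequality are at most [2 t]. *)
Lemma poincare_step (p0 q CA nu kP kappa t r0 eta : R) g y z :
  1 <= p0 -> p0 <= q -> 0 < CA -> 0 < t -> 0 < kP -> kP <= kappa -> 0 < eta ->
  kP * eta <= r0 ->
  (forall g, (forall x, 0 <= g x) -> (exists M : R, forall x, g x <= M) ->
      lower_semicontinuous (EFin \o g) ->
      forall x y, Omega x -> Omega y -> mdist x y < rho x / (3 * kP) ->
        (ereal_inf [set line_integral c.1.1 c.1.2 c.2 (EFin \o g)
                  | c in curves_between nu x y] <=
        (CA * mdist x y)%:E *
          (rmaximal mu Omega p0 w kP (kP * mdist x y)%R (EFin \o g) x +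
           rmaximal mu Omega p0 w kP (kP * mdist x y)%R (EFin \o g) y))%E) ->
  (forall x r, Omega x -> 0 < r < kappa * rho x -> (0 < W (ball x r) < +oo)%E) ->
  (forall x, 0 <= g x) -> (exists M : R, forall x, g x <= M) ->
  lower_semicontinuous (EFin \o g) ->
  Omega y -> Omega z ->
  ~ bad_set mu w Omega kappa q g r0 t y -> ~ bad_set mu w Omega kappa q g r0 t z ->
  mdist y z <= eta -> mdist y z < rho y / (3 * kP) ->
  joins (EFin \o g) y [set z] (5 * CA * t * eta).
Proof.
move=> p01 p0q CA0 t0 kP0 kPk eta0 etar0 poinc Wfin g0 gb lg Oy Oz yE zE yz yz'.
have bg := lower_semicontinuous_borel lg.
have mb := measurable_ball borel_measurable.
apply: (@joins_curve _ _ _ _ nu); apply: le_lt_trans (poinc g g0 gb lg _ _ Oy Oz yz') _.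
have p00 : 0 < p0 by lra.
have rm u : Omega u -> ~ bad_set mu w Omega kappa q g r0 t u ->
    (rmaximal mu Omega p0 w kP (kP * mdist y z) (EFin \o g) u <= (2 * t)%:E)%E.
  move=> Ou uE.
  have rk r : 0 < r < Num.min (kP * rho u) (kP * mdist y z) ->
      [/\ 0 < r, r < kappa * rho u & r < r0].
    rewrite lt_min => /andP[rp /andP[r1 r2]]; split=> //.
      by apply: (lt_le_trans r1); apply: ler_wpM2r => //; exact: mdist_set_ge0.
    apply: (lt_le_trans r2); apply: le_trans etar0; apply: ler_wpM2l => //.
    exact: ltW.
  apply/(sup_average_le w0) => //; first by rewrite mulr_ge0// ltW.
    by move=> r /rk[r1 r2 r3]; apply: Wfin => //; rewrite r1.
  move=> r /rk[r1 r2 r3].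
  apply: (wint_le_exponent borel_measurable bw w0 p01 p0q t0 g0 bg (mb _ _)).
  exact: (notin_bad_set uE Ou r1 r2 r3).
apply: (@le_lt_trans _ _ ((CA * mdist y z)%:E * (4 * t)%:E)%E).
  apply: lee_wpmul2l; first by rewrite lee_fin mulr_ge0 ?mdist_ge0// ltW.
  have -> : 4 * t = 2 * t + 2 * t by lra.
  by rewrite EFinD; apply: leeD; exact: rm.
rewrite -EFinM lte_fin.
have : 0 < CA * t * eta by rewrite !mulr_gt0.
have : CA * t * mdist y z <= CA * t * eta by apply: ler_wpM2l => //; rewrite mulr_ge0 ?ltW.
by lra.
Qed.

(** Without information on averages, quasiconvexity alone gives a path. *)
Lemma bounded_joins g (G : R) x : borel_fun (EFin \o g) -> (forall x, 0 <= g x) ->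
  (forall x, g x <= G) -> Omega x ->
  joins (EFin \o g) x (~` Omega) (2 * CQC * G * rho x).
Proof.
move=> bg g0 gG Ox; have rho0 := mdist_setC_gt0 Omega_open Omega_proper Ox.
have [z Oz xz] := mdist_set_adherent x Omega_proper rho0.
have G0 : 0 <= G by exact: le_trans (g0 x) (gG x).
have [||c [L [lc L0 c0 cL gc]]] := joins_quasiconvex (M := G) x z qc bg.
- by move=> y; rewrite lee_fin.
- by move=> y; rewrite lee_fin.
exists c, L; split => //; first by rewrite cL.
apply: le_trans gc _; rewrite lee_fin.
have H : 0 <= G * CQC by rewrite mulr_ge0// (le_trans _ CQC1).
have : G * CQC * mdist x z <= G * CQC * (2 * rho x) by apply: ler_wpM2l => //; lra.
by lra.
Qed.

End self_improvement.

(** Fix [g <= G] and argue by induction on [n] such that [G <= M^n * tau]. The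
   Hardy inequality for [level_sum] gives a path from [x] to the complement of
   [Omega] and a level [j] whose superlevel set meets the path in a set of
   length at most a small multiple of [rho x / M^(j+1)]. Chaining yields a point [y]
   off this superlevel set, at cost [O(tau * rho x)], with
   [rho y <= rho x / (2 M^(j+1))]. From [y] the induction hypothesis at height
   [M^(j+1) * tau] costs at most [K M^(j+1) tau rho y <= K tau rho x / 2]. The
   constant [K] is not deteriorated because the gain in distance offsets the
   growth of the height. *)
Theorem hardy_path_self_improvement (R : realType) (d : measure_display)
    (X : metricMeasurableType R d) (mu : {measure set X -> \bar R}) (CQC : R)
    (Omega : set X) (w : X -> \bar R) (p0 p : R) :
  let rho x := mdist_set x (~` Omega) in let W := wmeasure mu w in
  @borel R d X `<=` measurable -> doubling mu -> 1 <= CQC -> quasiconvex X CQC ->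
  open Omega -> ~` Omega !=set0 -> borel_fun w -> (forall x, (0 <= w x)%E) ->
  1 <= p0 -> p0 < p ->
  semilocally_doubling mu Omega w -> poincare_weight mu Omega CQC p0 w ->
  pointwise_hardy mu Omega p w ->
  exists q kappa K : R, [/\ p0 < q < p, 1 < kappa, 0 < K,
    forall x r, Omega x -> 0 < r <= kappa * rho x -> (0 < W (ball x r) < +oo)%E &
    forall g : X -> R, (forall x, 0 <= g x) -> (exists G : R, forall x, g x <= G) ->
      lower_semicontinuous (EFin \o g) ->
      forall x tau, Omega x -> 0 < tau ->
        (maximal mu Omega q w kappa (EFin \o g) x <= tau%:E)%E ->
        joins (EFin \o g) x (~` Omega) (K * tau * rho x)].
Proof.
move=> rho W borel_measurable mu_doubling cqc1 qc Omega_open Omega_proper bw w0.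
move=> p01 p0p wd [_ [CA [nu [kP [CA0 _ kP1 poinc]]]]] [CH [kH [CH0 kH1 hardy]]].
(* The weak type estimate for a ball involves the ball three times as large, and
   the radii in the Poincare inequality must be covered as well. *)
pose kappa := 3 * kH + kP.
have kappa1 : 1 < kappa by rewrite /kappa; lra.
have kappa0 : 0 < kappa by lra.
have kP0 : 0 < kP by lra.
have p_gt0 : 0 < p by lra.
have kPk : kP <= kappa by rewrite /kappa; lra.
have kHk : 3 * kH <= kappa by rewrite /kappa; lra.
have [|C [C1 wdC]] := wd (8 * kappa); first by rewrite mulr_gt0.
have {}wdC x r : Omega x -> 0 < r <= 8 * kappa * rho x ->
    (0 < W (ball x r) < +oo)%E /\ (W (ball x r) <= C%:E * W (ball x (r / 2)))%E.
  by move=> Ox rk; have [H1 H2 H3] := wdC x r Ox rk; rewrite H1 (le_lt_trans H2).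
have p1 : 1 < p by lra.
have C5 : 1 <= C ^+ 5 by exact: exprn_ege1.
pose K0 := 3 * C ^+ 5.
have K00 : 0 <= K0 by rewrite /K0; clear -C5; lra.
(* The factor [100] leaves room for the [8] in [beta] and the [1 / 12] in [eta / 2]. *)
have [|k k0 Hk] := @level_count_ex R K0 ((100 * CH * kP)^-1) p p1 K00.
  by rewrite invr_gt0 !mulr_gt0.
pose M := Num.max 2 (C ^+ 3).
have M2 : 2 <= M by rewrite le_max lexx.
have MC : C ^+ 3 <= M by rewrite le_max lexx orbT.
have M1 : 1 < M by apply: lt_le_trans M2; rewrite ltr1n.
have M0 : 0 <= M by exact/ltW/(lt_trans ltr01).
have Mk1 : 1 < M ^+ k by rewrite exprn_egt1 -?lt0n.
have [q [/andP[p0q qp] Mq]] := exponent_ex Mk1 p0p.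
pose A := (K0 * k%:R) `^ p^-1.
have kR : 1 <= k%:R :> R by rewrite ler1n.
have A0 : 0 < A by rewrite powR_gt0// mulr_gt0 ?ltr0n// mulr_gt0// (lt_le_trans _ C5).
(* [level_sum] has averages at most [4 * A] in the exponent [p]; doubling this
   gives the strict inequality that produces a path. *)
pose beta := 8 * CH * A.
have beta0 : 0 < beta by rewrite !mulr_gt0.
(* The first term serves the base of the induction, the second the chains. *)
pose K := 2 * CQC + 20 * CA * M ^+ k * beta.
have Mj j : 1 <= M ^+ j by apply: exprn_ege1; exact: ltW.
have Mj0 j : 0 < M ^+ j by exact: lt_le_trans (Mj j).
have K20 : 0 < 20 * CA * M ^+ k * beta by rewrite !mulr_gt0.
have K_gt0 : 0 < K by rewrite /K ltr_wpDl// mulr_ge0// (le_trans _ cqc1).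
have q1 : 1 <= q by clear -p01 p0q; lra.
have q_gt0 : 0 < q by exact: lt_le_trans q1.
have kk : kappa <= 8 * kappa by clear -kappa0; lra.
have rho_ge0 x : 0 <= rho x by exact: mdist_set_ge0.
have Wfin x r : Omega x -> 0 < r <= kappa * rho x -> (0 < W (ball x r) < +oo)%E.
  move=> Ox /andP[r0 rk]; have H : 0 < r <= 8 * kappa * rho x.
    by rewrite r0 (le_trans rk)//; apply: ler_wpM2r.
  by case: (wdC x r Ox H).
exists q, kappa, K; split => //; first by rewrite p0q.
move=> g g0 [G gG] lg x tau Ox tau0 Mx.
have bg := lower_semicontinuous_borel lg.
have gext x' : (0 <= (EFin \o g) x')%E by rewrite lee_fin.
have [n Gn] : exists n, G <= M ^+ n * tau.
  exists (Num.truncn (G / tau)).+1; rewrite -ler_pdivrMr//.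
  apply: le_trans (ltW (truncnS_gt _)) _; set m := _.+1.
  apply: (@le_trans _ _ (2 ^+ m)); first by rewrite -natrX ler_nat ltnW// ltn_expl.
  by apply: lerXn2r => //; rewrite nnegrE.
have {Mx} : forall r, 0 < r < kappa * rho x ->
    (wint mu w q (EFin \o g) (ball x r) <= (tau `^ q)%:E * W (ball x r))%E.
  apply/(sup_average_le w0) => //; first exact: ltW.
  by move=> r /andP[r0 rk]; apply: Wfin => //; rewrite r0 ltW.
elim: n x tau Ox tau0 Gn => [|n IH] x tau Ox tau0 Gn Hx.
  apply: joins_le (bounded_joins cqc1 qc Omega_open Omega_proper bg g0 gG Ox).
  have : 2 * CQC * G * rho x <= 2 * CQC * tau * rho x.
    apply: ler_wpM2r => //; apply: ler_wpM2l; last by rewrite expr0 mul1r in Gn.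
    by rewrite mulr_ge0// (le_trans _ cqc1).
  have : 0 <= (20 * CA * M ^+ k * beta) * tau * rho x.
    by rewrite mulr_ge0// mulr_ge0// ltW.
  by rewrite /K; clear; lra.
have rho0 := mdist_setC_gt0 Omega_open Omega_proper Ox.
pose E := level_set mu w Omega kappa M q g x tau.
pose h := level_sum M k E.
have Eo j : open (E j) by exact: level_set_open.
have hE : (maximal mu Omega p w kH (EFin \o h) x <= (4 * A)%:E)%E.
  have kHr : 3 * (kH * rho x) <= kappa * rho x.
    by rewrite mulrA; exact: ler_wpM2r.
  apply/(sup_average_le w0) => //; first by rewrite mulr_ge0// ltW.
    move=> r /andP[r0 rk]; apply: Wfin => //; rewrite r0/=.
    by clear -kHr r0 rk; lra.
  move=> r /andP[r0 rk].
  have r3 : 3 * r < kappa * rho x by clear -kHr rk; lra.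
  apply: le_trans (wint_level_sum borel_measurable mu_doubling bw w0 C1 wdC
    M2 MC q1 (ltW qp) Mq bg Ox tau0 Hx r0 r3) _.
  apply: lee_wpmul2r; first exact: integral_ge0.
  rewrite lee_fin powRM ?(ltW A0)//; apply: ler_wpM2l; first exact: powR_ge0.
  rewrite /A -powRrM mulVf ?powRr1; [|by rewrite mulr_ge0|by rewrite gt_eqF].
  have : 1 * 1 <= k%:R * C ^+ 5 by apply: ler_pM.
  by rewrite /K0; clear; lra.
have [c [L [lc L0 c0 cL hc]]] : joins (EFin \o h) x (~` Omega) (beta * rho x).
  apply: (hardy_joins qc Omega_proper hardy (M := 1 + \sum_(j < k) M ^+ j.+1)) => //.
  - exact: borel_level_sum.
  - by move=> y; rewrite lee_fin level_sum_ge0.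
  - by move=> y; rewrite lee_fin level_sum_bound.
  apply: (@le_lt_trans _ _ ((CH * rho x)%:E * (4 * A)%:E)%E).
    by apply: lee_wpmul2l => //; rewrite lee_fin mulr_ge0// ltW.
  rewrite -EFinM lte_fin /beta.
  have : 0 < CH * A * rho x by rewrite !mulr_gt0.
  by clear; lra.
have B0 : 0 <= beta * rho x by rewrite mulr_ge0// ltW.
have [Lb [j Ej]] := short_level_ex M2 k0 (g := g) lc L0 B0 hc.
pose t := M ^+ j.+1 * tau.
have Mj1 := Mj j.+1.
have Mj2 : 2 <= M ^+ j.+1.
  by apply: (le_trans M2); rewrite exprS ler_peMr.
have kr : rho x <= kappa * rho x by rewrite ler_peMl// ltW.
have MjV : 0 < (M ^+ j.+1)^-1 by rewrite invr_gt0.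
have MjVE : M ^+ j.+1 * (M ^+ j.+1)^-1 = 1 by rewrite mulfV// gt_eqF.
have t0 : 0 < t by rewrite mulr_gt0.
pose s := rho x * (M ^+ j.+1)^-1.
have s0 : 0 < s by rewrite mulr_gt0.
have sx : s <= rho x / 2.
  by apply: ler_wpM2l => //; rewrite lef_pV2 ?posrE.
have kPV : 0 < kP^-1 by rewrite invr_gt0.
have kPVE : kP * kP^-1 = 1 by rewrite mulfV// gt_eqF.
have kPV1 : kP^-1 <= 1 by rewrite invf_le1// ltW.
have s60 : 0 < s / 6 by rewrite divr_gt0.
(* Jumps of size [eta] at points with [s / 2 < rho y] satisfy the smallness
   condition of the Poincare inequality. *)
pose eta := s / 6 * kP^-1.
have eta0 : 0 < eta by rewrite mulr_gt0.
have kPeta : kP * eta = s / 6 by rewrite /eta mulrCA kPVE mulr1.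
have etas : eta <= s / 2.
  have : s / 6 * kP^-1 <= s / 6 * 1 by apply: ler_wpM2l => //; exact: ltW.
  by rewrite -/eta; clear -s0; lra.
have K'0 : 0 <= 5 * CA * t by rewrite !mulr_ge0// ltW.
have [||||y [Oy yE ys yj]] := @chain_to_boundary R d X Omega (EFin \o g) (E j) c L
   (5 * CA * t) eta (s / 2) bg gext (Eo j) lc L0 cL _ _ eta0 etas K'0.
- by rewrite c0.
- rewrite c0; exact: (notin_level_set_center borel_measurable bw w0 C1 wdC M2 MC q1 bg tau0 Hx).
- apply: le_lt_trans Ej _; rewrite lte_fin.
  have sP : 0 < s * kP^-1 by rewrite mulr_gt0.
  have kR0 : 0 < k%:R :> R by rewrite ltr0n.
  have Ak : 100 * CH * (A / k%:R) <= kP^-1.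
    have CH100 : 0 < 100 * CH by rewrite mulr_gt0.
    by rewrite -ler_pdivlMl// ler_pdivrMr// -invfM.
  have -> : beta * rho x / k%:R / M ^+ j.+1 = 8 * (CH * (A / k%:R)) * s.
    by rewrite /beta /s; ring.
  have : 100 * CH * (A / k%:R) * s <= kP^-1 * s by apply: ler_wpM2r => //; exact: ltW.
  by rewrite /eta; clear -sP; lra.
- move=> y z Oy Oz yE zE sy yz.
  apply: (@poincare_step _ _ _ mu Omega w borel_measurable Omega_proper bw w0
    p0 q CA nu kP kappa t (kappa * rho x / 4) eta g y z) => //.
  + exact: ltW.
  + by rewrite kPeta; clear -sx kr s0; lra.
  + by move=> x' r Ox' /andP[r0 rk]; apply: Wfin => //; rewrite r0 ltW.
  + by exists G.
  + rewrite invfM mulrA.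
    have : s / 2 * kP^-1 < rho y * kP^-1 by rewrite ltr_pM2r.
    by move: yz; rewrite /eta; clear; lra.
rewrite c0 in yj.
(* As [rho y] is small, the truncation of radii in [E j] is no restriction at [y]. *)
have yH r : 0 < r < kappa * rho y ->
    (wint mu w q (EFin \o g) (ball y r) <= (t `^ q)%:E * W (ball y r))%E.
  move=> /andP[r0 rk]; apply: (notin_bad_set yE Oy r0 rk).
  apply: (lt_le_trans rk).
  have : kappa * rho y <= kappa * (s / 2) by apply: ler_wpM2l => //; exact: ltW.
  have : kappa * s <= kappa * (rho x / 2) by apply: ler_wpM2l => //; exact: ltW.
  by clear; lra.
have Gt : G <= M ^+ n * t.
  apply: (le_trans Gn); rewrite exprSr /t -mulrA; apply: ler_wpM2l.
    exact: exprn_ge0.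
  by apply: ler_wpM2r; [exact: ltW|rewrite exprS ler_peMr].
apply: joins_le (joins_trans bg gext yj (IH y t Oy t0 Gt yH)).
have K0' : 0 <= K by exact: ltW.
have ts : t * s = tau * rho x.
  transitivity (M ^+ j.+1 * (M ^+ j.+1)^-1 * (tau * rho x)); last by rewrite MjVE mul1r.
  by rewrite /t /s; ring.
have H1 : K * t * rho y <= K * t * (s / 2) by apply: ler_wpM2l => //; rewrite mulr_ge0// ltW.
have H2 : K * t * (s / 2) = K * (tau * rho x) / 2 by rewrite -ts; ring.
have tk : t <= M ^+ k * tau.
  by apply: ler_wpM2r; [exact: ltW|apply: ler_weXn2l => //; exact: ltW].
have H3 : 5 * CA * t * L <= 5 * CA * (M ^+ k * tau) * (beta * rho x).
  by apply: ler_pM => //; apply: ler_wpM2l => //; rewrite mulr_ge0// ltW.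
have H4 : 20 * CA * M ^+ k * beta * (tau * rho x) <= K * (tau * rho x).
  by apply: ler_wpM2r; [rewrite mulr_ge0// ltW|rewrite /K lerDr mulr_ge0// (le_trans _ cqc1)].
by clear -H1 H2 H3 H4; lra.
Qed.

(** * Outer regularity of finite Borel measures *)

Section borel_regularity.
Context {R : realType} {d : measure_display} {X : metricMeasurableType R d}.
Hypothesis borel_measurable : @borel R d X `<=` measurable.
Variable nu : {measure set X -> \bar R}.
Hypothesis nu_fin : (nu setT < +oo)%E.

Let open_meas (A : set X) : open A -> measurable A.
Proof. by move=> oA; apply: borel_measurable; exact: sub_sigma_algebra. Qed.

Let closed_meas (A : set X) : closed A -> measurable A.
Proof.
by move=> cA; rewrite -[A]setCK; apply: measurableC; apply: open_meas; exact: closed_openC.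
Qed.

Let nu_fin' (A : set X) : measurable A -> (nu A < +oo)%E.
Proof. by move=> mA; apply: le_lt_trans nu_fin; apply: le_measure; rewrite ?inE. Qed.

Lemma nonincreasing_measure_lt (G : nat -> set X) (e : \bar R) :
  (forall n, measurable (G n)) -> nonincreasing_seq G ->
  (nu (\bigcap_n G n) < e)%E -> exists n, (nu (G n) < e)%E.
Proof.
move=> mG dG Ge; apply: contrapT => /forallNP H.
have := nonincreasing_cvg_mu (nu_fin' (mG 0%N)) mG (bigcapT_measurable mG) dG.
move=> /cvg_lim limE; move: Ge; rewrite -limE//.
rewrite ltNge => /negP; apply; apply: lime_ge.
  by apply: ereal_nonincreasing_is_cvgn => n m nm; apply: le_measure; rewrite ?inE//;
    apply/subsetPset; exact: dG.
by apply: nearW => n; rewrite leNgt; apply/negP; exact: H.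
Qed.

Let approximable (A : set X) := forall e : R, 0 < e -> exists F U,
  [/\ closed F, open U, F `<=` A, A `<=` U & (nu (U `\` F) < e%:E)%E].

(* An open set is the increasing union of the closed sets of its points at
   distance at least [1 / (n + 1)] from the complement. *)
Let approximable_open (A : set X) : open A -> approximable A.
Proof.
move=> oA e e0; case: (pselect (~` A !=set0)) => [cA0|/nonemptyPn cA0]; last first.
  have -> : A = setT by rewrite -[A]setCK cA0 setC0.
  exists setT, setT; split; [exact: closedT|exact: openT|by []|by []|].
  by rewrite setDv measure0 lte_fin.
pose F n := [set x : X | n.+1%:R^-1 <= mdist_set x (~` A)].
have cF n : closed (F n).
  rewrite -[F n]setCK; apply: open_closedC; rewrite openE => x /= /negP; rewrite -ltNge => xn.
  apply/nbhs_ballP; exists (n.+1%:R^-1 - mdist_set x (~` A)) => /=; first by rewrite subr_gt0.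
  move=> y; rewrite ballEmdist /= => xy; apply/negP; rewrite -ltNge.
  apply: le_lt_trans (mdist_set_triangle y x cA0) _.
  by rewrite metric_sym -ltrBrDr.
have FA n : F n `<=` A.
  move=> x /= Fx; apply: contrapT => Ax; have := mdist_set_le x (E := ~` A) Ax.
  rewrite mdistxx => /(le_trans Fx); rewrite leNgt invr_gt0.
  by rewrite ltr0n.
have [n Hn] : exists n, (nu (A `\` F n) < e%:E)%E.
  apply: nonincreasing_measure_lt.
  - by move=> n; apply: measurableD; [exact: open_meas|exact: closed_meas].
  - move=> n m nm; apply/subsetPset => x [Ax Fm]; split => // Fn; apply: Fm.
    by apply: le_trans Fn; rewrite lef_pV2 ?posrE ?ltr0n// ler_nat.
  suff -> : \bigcap_n (A `\` F n) = set0 by rewrite measure0 lte_fin.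
  apply/seteqP; split => // x H; have [Ax _] := H 0%N I.
  have r0 := mdist_setC_gt0 oA cA0 Ax.
  have [_ /=] := H (Num.truncn (mdist_set x (~` A))^-1) I; apply.
  rewrite /F /= -[leRHS]invrK lef_pV2 ?posrE ?ltr0n ?invr_gt0//.
  exact/ltW/truncnS_gt.
by exists (F n), A; split.
Qed.

Let approximableC (A : set X) : approximable A -> approximable (~` A).
Proof.
move=> aA e e0; have [F [U [cF oU FA AU UF]]] := aA e e0.
exists (~` U), (~` F); split.
- exact: open_closedC.
- exact: closed_openC.
- exact: subsetC.
- exact: subsetC.
- by rewrite setDE setCK setIC -setDE.
Qed.

Let approximable_bigcup (A : nat -> set X) : (forall n, approximable (A n)) ->
  approximable (\bigcup_n A n).
Proof.
move=> aA e e0; pose en n := (e / 2) / (2 ^ n.+1)%:R.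
have en0 n : 0 < en n by rewrite !divr_gt0.
have /choice[FU HFU] : forall n, exists p : set X * set X,
    [/\ closed p.1, open p.2, p.1 `<=` A n, A n `<=` p.2 & (nu (p.2 `\` p.1) < (en n)%:E)%E].
  by move=> n; have [F [U H]] := aA n _ (en0 n); exists (F, U).
pose F n := (FU n).1; pose U n := (FU n).2.
have cF n : closed (F n) by case: (HFU n).
have oU n : open (U n) by case: (HFU n).
have FA n : F n `<=` A n by case: (HFU n).
have AU n : A n `<=` U n by case: (HFU n).
have UF n : (nu (U n `\` F n) < (en n)%:E)%E by case: (HFU n).
pose Fs N := \bigcup_(i < N) F i.
have cFs N : closed (Fs N).
  by apply: closed_bigcup => // ; exact: finite_II.
have oUs : open (\bigcup_n U n) by exact: bigcup_open.
have [N HN] : exists N, (nu ((\bigcup_n U n) `\` Fs N) < e%:E)%E.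
  apply: nonincreasing_measure_lt.
  - by move=> N; apply: measurableD; [exact: open_meas|exact: closed_meas].
  - move=> n m nm; apply/subsetPset => x [Ux Fx]; split => // -[i /= im Fi]; apply: Fx.
    by exists i => //=; exact: leq_trans nm.
  apply: (@le_lt_trans _ _ (nu (\bigcup_n (U n `\` F n)))).
    apply: le_measure; rewrite ?inE.
    - apply: bigcapT_measurable => N; apply: measurableD; [exact: open_meas|exact: closed_meas].
    - by apply: bigcup_measurable => n _; apply: measurableD; [exact: open_meas|exact: closed_meas].
    move=> x H; have [[n _ Ux] _] := H 0%N I; exists n => //; split => // Fx.
    by have [_] := H n.+1 I; apply; exists n => //=.
  apply: (@le_lt_trans _ _ (\sum_(n <oo) nu (U n `\` F n))%E).
    apply: measure_sigma_subadditive => //.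
    - by move=> n; apply: measurableD; [exact: open_meas|exact: closed_meas].
    - by apply: bigcup_measurable => n _; apply: measurableD; [exact: open_meas|exact: closed_meas].
  apply: (@le_lt_trans _ _ (\sum_(n <oo) (en n)%:E)%E).
    by apply: lee_nneseries => // n _; exact: ltW.
  apply: (@le_lt_trans _ _ (e / 2)%:E); last by rewrite lte_fin; lra.
  by apply: epsilon_trick0; lra.
exists (Fs N), (\bigcup_n U n); split => //.
- by move=> x [i _ Fx]; exists i => //; exact: FA.
- by move=> x [i _ Ax]; exists i => //; exact: AU.
Qed.

(** Outer regularity alone is not stable under complements; sets approximable from
   both sides form a sigma-algebra. *)
Lemma borel_outer_regular (A : set X) (e : R) : borel A -> 0 < e ->
  exists U, [/\ open U, A `<=` U & (nu (U `\` A) < e%:E)%E].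
Proof.
move=> bA e0; suff : approximable A.
  move=> /(_ e e0)[F [U [cF oU FA AU UF]]]; exists U; split => //.
  apply: le_lt_trans UF; apply: le_measure; rewrite ?inE.
  - by apply: measurableD; [exact: open_meas|exact: borel_measurable].
  - by apply: measurableD; [exact: open_meas|exact: closed_meas].
  - exact: setDS.
move: A bA; apply: smallest_sub.
  split => [|A aA|A aA].
  - by apply: approximable_open; exact: open0.
  - by rewrite setTD; exact: approximableC.
  - exact: approximable_bigcup.
by move=> A; exact: approximable_open.
Qed.

End borel_regularity.

(** * Lower semicontinuous majorants *)

Section lower_semicontinuous_majorant.
Context {R : realType} {d : measure_display} {X : metricMeasurableType R d}.
Implicit Types (x y : X).

Lemma lower_semicontinuous_near (h : X -> R) :
  (forall x, \forall y \near x, h x <= h y) -> lower_semicontinuous (EFin \o h).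
Proof.
move=> H x a ax; exists [set y | h x <= h y]; first exact: H.
by move=> y /= xy; apply: lt_le_trans ax _; rewrite lee_fin.
Qed.

(** The sum is [f] rounded up to a multiple of [delta]. *)
Lemma staircase_bounds (delta f : R) n : 0 < delta -> 0 <= f -> f <= n%:R * delta ->
  f <= \sum_(i < n) delta * (i%:R * delta < f)%R%:R <= f + delta.
Proof.
move=> d0 f0 fn.
pose S m := \sum_(i < m) delta * (i%:R * delta < f)%R%:R.
have H m : Num.min f (m%:R * delta) <= S m /\ S m <= f + delta /\ S m <= m%:R * delta.
  elim: m => [|m [IH1 [IH2 IH3]]].
    by rewrite /S big_ord0 mul0r ge_min lexx orbT; split=> //; split => //; lra.
  rewrite /S big_ord_recr /= -/(S m) -natr1 mulrDl mul1r.
  case: ltP => fm; last first.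
    rewrite mulr0 addr0; split; last by split => //; lra.
    by rewrite min_l; [move: IH1; rewrite min_l|lra].
  rewrite mulr1; split; last by split; lra.
  rewrite ge_min; apply/orP; right.
  by move: IH1; rewrite min_r; [lra|exact: ltW].
have [H1 [H2 _]] := H n; apply/andP; split => //.
by move: H1; rewrite min_l.
Qed.

Lemma near_indic_sum_le (delta : R) (U : nat -> set X) n x : 0 <= delta ->
  (forall i, open (U i)) ->
  \forall y \near x, \sum_(i < n) delta * \1_(U i) x <= \sum_(i < n) delta * \1_(U i) y.
Proof.
move=> delta0 oU; elim: n => [|n IH].
  by apply: nearW => y; rewrite !big_ord0.
have Un : \forall y \near x, delta * \1_(U n) x <= delta * \1_(U n) y.
  case: (pselect (U n x)) => [Ux|nUx].
    have : \forall y \near x, U n y by exact: open_nbhs_nbhs.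
    by apply: filterS => y Uy; rewrite !indicE !mem_set.
  by apply: nearW => y; rewrite !indicE memNset// mulr0 mulr_ge0.
by apply: filterS2 IH Un => y IHy Uy; rewrite !big_ord_recr /=; exact: lerD.
Qed.

Variables (mu : {measure set X -> \bar R}) (w : X -> \bar R).
Hypotheses (borel_measurable : @borel R d X `<=` measurable)
  (bw : borel_fun w) (w0 : forall x, (0 <= w x)%E).
Local Notation W := (wmeasure mu w).

(** Vitali-Caratheodory: replace each superlevel set in a staircase by an
   open set of nearly the same measure. *)
Lemma lsc_majorant (f : X -> R) (G e : R) (B : set X) : borel_fun (EFin \o f) ->
  0 < G -> (forall x, 0 <= f x <= G) -> 0 < e -> measurable B -> (W B < +oo)%E ->
  exists F : X -> R, [/\ forall x, f x <= F x, forall x, F x <= G,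
    (forall x, \forall y \near x, F x <= F y) &
    forall A, measurable A -> A `<=` B ->
      (\int[mu]_(x in A) ((F x)%:E * w x) <= \int[mu]_(x in A) ((f x)%:E * w x) + e%:E)%E].
Proof.
move=> bf G0 fG e0 mB WB.
have mw : measurable_fun setT w by exact: borel_measurable_fun.
have [Wm WmE] := integral_measure_ex mu w0 mw.
have W0 A : (0 <= W A)%E by exact: integral_ge0.
pose b := fine (W B).
have bE : W B = b%:E by rewrite /b fineK// ge0_fin_numE.
have b0 : 0 <= b by rewrite -lee_fin -bE.
pose N := (Num.truncn (2 * G * b / e)).+1.
have N0 : 0 < N%:R :> R by rewrite ltr0n.
pose delta := G / N%:R.
have delta0 : 0 < delta by rewrite divr_gt0.
have Ndelta : N%:R * delta = G by rewrite mulrC divfK// gt_eqF.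
have deltab : delta * b <= e / 2.
  rewrite /delta mulrAC ler_pdivrMr//.
  have := ltW (truncnS_gt (2 * G * b / e)); rewrite ler_pdivrMr// -/N => H.
  by clear -H; lra.
pose nu := mrestr Wm mB.
have nu_fin : (nu setT < +oo)%E by rewrite /nu /mrestr setTI WmE.
pose A i := [set x | i%:R * delta < f x].
have bA i : borel (A i).
  have := bf `](i%:R * delta)%:E, +oo[%classic (emeasurable_itv _).
  congr (borel _); apply/seteqP; split => x; rewrite /= in_itv/= andbT lte_fin //.
have mA i : measurable (A i) by exact: borel_measurable.
(* [N] sets with excess at most [e / (2 * G)], each weighted by [G / N]. *)
have e2 : 0 < e / (2 * G) by rewrite divr_gt0// mulr_gt0.
have /choice[U HU] : forall i, exists U,
    [/\ open U, A i `<=` U & (nu (U `\` A i) < (e / (2 * G))%:E)%E].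
  move=> i; exact: (borel_outer_regular borel_measurable nu_fin).
have mU i : measurable (U i).
  by apply: borel_measurable; apply: sub_sigma_algebra; case: (HU i).
pose F x : R := \sum_(i < N) delta * \1_(U i) x.
have stair x : f x <= \sum_(i < N) delta * (i%:R * delta < f x)%R%:R <= f x + delta.
  by apply: staircase_bounds => //; have /andP[] := fG x => // _; rewrite Ndelta.
have Fnear x : \forall y \near x, F x <= F y.
  by apply: (@near_indic_sum_le delta U N x (ltW delta0)) => i; case: (HU i).
exists F; split.
- move=> x; have /andP[H _] := stair x; apply: (le_trans H).
  apply: ler_sum => i _; apply: ler_wpM2l; first exact: ltW.
  case: ltP => fx //; have [_ AU _] := HU i.
  by rewrite indicE mem_set//; exact: AU.
- move=> x; rewrite -[leRHS]Ndelta /F.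
  apply: (@le_trans _ _ (\sum_(i < N) delta)); last first.
    by rewrite sumr_const card_ord mulr_natl.
  apply: ler_sum => i _; apply: ler_piMr; first exact: ltW.
  by rewrite indicE; case: (_ \in _).
- exact: Fnear.
move=> S mS SB.
pose D i := U i `\` A i.
have mD i : measurable (D i) by exact: measurableD.
have wD0 i x : (0 <= (w \_ (D i)) x)%E by rewrite patchE; case: ifP.
have mwD i : measurable_fun setT (w \_ (D i)).
  by apply/(measurable_restrictT _ (mD i)).1; exact: measurable_funTS.
have f0 x : 0 <= f x by have /andP[] := fG x.
have mf : measurable_fun setT (EFin \o f) by exact: borel_measurable_fun.
pose E x : \bar R := (\sum_(i < N) delta%:E * (w \_ (D i)) x)%E.
have E0 x : (0 <= E x)%E.
  by apply: sume_ge0 => i _; rewrite mule_ge0// lee_fin ltW.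
have mE : measurable_fun setT E.
  by apply: emeasurable_sum => i; exact: measurable_funeM.
have fw0 x : (0 <= (f x)%:E * w x)%E by rewrite mule_ge0// lee_fin.
have dw0 x : (0 <= delta%:E * w x)%E by rewrite mule_ge0// lee_fin ltW.
have mfw : measurable_fun setT (fun x => (f x)%:E * w x)%E by exact: emeasurable_funM.
have mdw : measurable_fun setT (fun x => delta%:E * w x)%E by exact: measurable_funeM.
have mF : measurable_fun setT (EFin \o F).
  apply: borel_measurable_fun => //; apply: lower_semicontinuous_borel.
  exact: lower_semicontinuous_near Fnear.
apply: (@le_trans _ _ (\int[mu]_(x in S) ((f x)%:E * w x + (delta%:E * w x + E x)))%E).
  apply: ge0_le_integral => //.
  - move=> x _; rewrite mule_ge0// lee_fin; have /andP[+ _] := stair x.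
    by move=> _; apply: sumr_ge0 => i _; rewrite mulr_ge0// ltW.
  - by apply: measurable_funTS; exact: emeasurable_funM.
  - by apply: measurable_funTS; apply: emeasurable_funD => //; exact: emeasurable_funD.
  move=> x _.
  have -> : E x = ((\sum_(i < N) delta * (x \in D i)%:R)%:E * w x)%E.
    rewrite -sumEFin ge0_sume_distrl; last first.
      by move=> i _; rewrite lee_fin mulr_ge0// ltW.
    apply: eq_bigr => i _; rewrite (EFinM delta) -muleA patchE.
    by case: ifP => _; rewrite ?mul1e ?mul0e.
  have SD0 : 0 <= \sum_(i < N) delta * (x \in D i)%:R.
    by apply: sumr_ge0 => i _; rewrite mulr_ge0// ltW.
  rewrite -!ge0_muleDl ?lee_fin ?addr_ge0 ?(ltW delta0)//.
  apply: lee_wpmul2r => //; rewrite -!EFinD lee_fin addrA.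
  have /andP[_ H] := stair x; apply: le_trans (lerD H (lexx _)).
  rewrite /F -big_split /=; apply: ler_sum => i _; rewrite -mulrDr.
  apply: ler_wpM2l; first exact: ltW.
  rewrite indicE; case: (boolP (x \in U i)) => [/set_mem Ux|_]; last exact: addr_ge0.
  case: ltP => fx; first by rewrite lerDl.
  rewrite mem_set ?add0r//; split => //; rewrite /A /=; apply/negP; rewrite -leNgt//.
rewrite ge0_integralD//; last 3 first.
- exact: measurable_funTS.
- by move=> x _; exact: adde_ge0.
- by apply: measurable_funTS; exact: emeasurable_funD.
apply: leeD => //; rewrite ge0_integralD//; last 2 first.
- exact: measurable_funTS.
- exact: measurable_funTS.
rewrite [e]splitr EFinD; apply: leeD.
  rewrite ge0_integralZl_EFin ?(ltW delta0)//; last exact: measurable_funTS.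
  apply: (@le_trans _ _ (delta%:E * W B)%E); last by rewrite bE -EFinM lee_fin.
  apply: lee_wpmul2l; first by rewrite lee_fin ltW.
  exact: wmeasure_subset.
rewrite ge0_integral_sum//; last 2 first.
- by move=> i; apply: measurable_funTS; exact: measurable_funeM.
- by move=> i x _; rewrite mule_ge0// lee_fin ltW.
apply: (@le_trans _ _ ((N%:R * delta)%:E * (e / (2 * G))%:E)%E); last first.
  by rewrite Ndelta -EFinM lee_fin le_eqVlt; apply/orP; left; apply/eqP; field; rewrite gt_eqF.
apply: lee_sum_cst; [exact: ltW|by rewrite lee_fin ltW|].
move=> i; rewrite ge0_integralZl_EFin ?(ltW delta0)//; last exact: measurable_funTS.
apply: lee_wpmul2l; first by rewrite lee_fin ltW.
rewrite -integral_mkcondr; have [_ _ /ltW] := HU i; apply: le_trans.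
rewrite /nu /mrestr WmE; apply: wmeasure_subset => //.
- exact: measurableI.
- exact: (measurableI _ _ (mD i) mB).
by move=> x [Sx Dx]; split => //; exact: SB.
Qed.

End lower_semicontinuous_majorant.

(** * From paths back to Hardy inequalities *)

Section last_exit.
Context {R : realType} {d : measure_display} {X : metricMeasurableType R d}.

(** After this time the path avoids the ball in which the majorant used in
   [hardy_of_paths] is set to zero. *)
Lemma last_exit_ex (c : R -> X) (L r : R) : lip1 c -> 0 <= L -> 0 <= r ->
  exists s, [/\ 0 <= s <= L, mdist (c 0) (c s) <= r &
    forall t, s < t -> t <= L -> r < mdist (c 0) (c t)].
Proof.
move=> lc L0 r0.
pose S := [set s | 0 <= s <= L /\ mdist (c 0) (c s) <= r].
have S0 : S 0 by rewrite /S /= lexx L0 mdistxx.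
have Ssup : has_sup S by split; [exists 0|exists L => s [/andP[]]].
have subS s : S s -> s <= sup S by apply: ub_le_sup; case: Ssup.
exists (sup S); split.
- rewrite subS//; apply: sup_le_ub; [by exists 0|by move=> s [/andP[]]].
- apply/ler_addgt0Pr => e e0; have [s Ss sS] := sup_adherent e0 Ssup.
  have [_ Hs] := Ss; have := metric_triangle (c 0) (c s) (c (sup S)).
  have := lc s (sup S); rewrite ler0_norm ?subr_le0 ?subS//.
  by move: Hs sS; lra.
- move=> t tS tL; rewrite ltNge; apply/negP => H.
  have : t <= sup S by apply: (subS t); split => //; rewrite tL (le_trans (subS _ S0))// ltW.
  by rewrite leNgt tS.
Qed.

End last_exit.

(** A lower semicontinuous majorant of [g^q] with nearly the same integral has
   nearly the same averages over balls around [x] only if their radii are bounded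
   below. Hence the majorant is set to zero in a closed ball of small radius
   around [x], and the upper gradient inequality is used only on the part of the
   path after its last exit from that ball; the remaining increment of [u] is
   small since [u] is Lipschitz. *)
Theorem hardy_of_paths (R : realType) (d : measure_display)
    (X : metricMeasurableType R d) (mu : {measure set X -> \bar R})
    (Omega : set X) (w : X -> \bar R) (q kappa K : R) :
  let rho x := mdist_set x (~` Omega) in let W := wmeasure mu w in
  @borel R d X `<=` measurable -> open Omega -> ~` Omega !=set0 ->
  borel_fun w -> (forall x, (0 <= w x)%E) ->
  0 < q -> 1 < kappa -> 0 < K ->
  (forall x r, Omega x -> 0 < r <= kappa * rho x -> (0 < W (ball x r) < +oo)%E) ->
  (forall g : X -> R, (forall x, 0 <= g x) -> (exists G : R, forall x, g x <= G) ->
      lower_semicontinuous (EFin \o g) ->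
      forall x tau, Omega x -> 0 < tau ->
        (maximal mu Omega q w kappa (EFin \o g) x <= tau%:E)%E ->
        joins (EFin \o g) x (~` Omega) (K * tau * rho x)) ->
  pointwise_hardy mu Omega q w.
Proof.
move=> rho W borel_measurable Omega_open Omega_proper bw w0 q0 k1 K0 Wfin paths.
exists K, kappa; split => // u g [[Lu Hu] u0] ug [G gG] x Ox.
have [bg g0 ugc] := ug.
have rho0 : 0 < rho x by exact: mdist_setC_gt0.
have k0 : 0 < kappa by lra.
have mb := measurable_ball borel_measurable.
have max0 : (0 <= maximal mu Omega q w kappa g x)%E by apply: ereal_sup_ubound; left.
case mE : (maximal mu Omega q w kappa g x) => [m| |]; last 2 first.
- by rewrite gt0_muley ?leey// lte_fin mulr_gt0.
- by rewrite mE in max0.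
have m0 : 0 <= m by rewrite -lee_fin -mE.
rewrite -EFinM lee_fin.
pose L0 := `|Lu| + 1.
have L00 : 0 < L0 by rewrite ltr_wpDl.
pose G1 := `|G| + 1.
have G10 : 0 < G1 by rewrite ltr_wpDl.
pose f y := fine (g y) `^ q.
have gE y : g y = (fine (g y))%:E.
  by rewrite fineK// ge0_fin_numE//; exact: le_lt_trans (gG y) (ltry _).
have fg0 y : 0 <= fine (g y) by rewrite fine_ge0.
have fG y : 0 <= f y <= G1 `^ q.
  rewrite powR_ge0 /=; apply: ge0_ler_powR; rewrite ?nnegrE ?(ltW q0) ?(ltW G10)//.
  by rewrite -lee_fin -gE (le_trans (gG y))// lee_fin /G1 (le_trans (ler_norm G))// lerDl.
have bf : borel_fun (EFin \o f).
  have -> : EFin \o f = fun y => (g y `^ q)%E.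
    by apply/funext => y /=; rewrite gE poweR_EFin.
  apply/borel_funP; apply: (measurableT_comp (measurable_poweR q)).
  exact/borel_funP.
have Hx : forall r, 0 < r < kappa * rho x ->
    (wint mu w q g (ball x r) <= (m `^ q)%:E * W (ball x r))%E.
  apply/(sup_average_le w0) => //; last by rewrite /sup_average -mE.
  by move=> r /andP[r0 rk]; apply: Wfin => //; rewrite r0 ltW.
apply/ler_addgt0Pr => e0 e00.
(* [e] bounds both the loss in the maximal function and the cut-off radius. *)
pose e := e0 / (2 * (K * rho x + L0)).
have KL0 : 0 < K * rho x + L0 by rewrite addr_gt0// mulr_gt0.
have e_gt0 : 0 < e by rewrite divr_gt0// mulr_gt0.
have eE : e * (K * rho x) + e * L0 <= e0.
  rewrite -mulrDr /e mulrAC ler_pdivrMr ?mulr_gt0//.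
  have : 0 < e0 * (K * rho x + L0) by rewrite mulr_gt0.
  by clear; lra.
pose tau := m + e.
have tau0 : 0 < tau by rewrite /tau; lra.
have mtau : m `^ q < tau `^ q.
  by apply: gt0_ltr_powR; rewrite ?nnegrE ?(ltW tau0)//; rewrite /tau; lra.
have [r0 [r00 r0e r0k]] : exists r, [/\ 0 < r, r <= e & r <= kappa * rho x].
  exists (Num.min e (kappa * rho x)); rewrite lt_min e_gt0 mulr_gt0//.
  by rewrite !ge_min !lexx orbT.
have /andP[B00 B0oo] : (0 < W (ball x r0) < +oo)%E by apply: Wfin => //; rewrite r00.
pose b0 := fine (W (ball x r0)).
have b0E : W (ball x r0) = b0%:E by rewrite /b0 fineK// ge0_fin_numE// ltW.
have b00 : 0 < b0 by rewrite -lte_fin -b0E.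
pose B := ball x (kappa * rho x).
have /andP[_ WB] : (0 < W B < +oo)%E by apply: Wfin => //; rewrite lexx mulr_gt0.
(* The error is a fraction of the measure of the cut-off ball, which every larger
   ball around [x] contains. *)
have [|F [fF FG Fnear Fint]] := @lsc_majorant _ _ _ mu w borel_measurable bw w0 f
  (G1 `^ q) ((tau `^ q - m `^ q) * b0) B bf (powR_gt0 q G10) fG _ (mb _ _) WB.
  by rewrite mulr_gt0// subr_gt0.
pose V := [set y | r0 < mdist x y].
have oV : open V.
  rewrite openE => y /= xy; apply/nbhs_ballP; exists (mdist x y - r0) => /=.
    by rewrite subr_gt0.
  move=> z; rewrite ballEmdist /V /= => yz.
  have := metric_triangle x z y; rewrite (metric_sym z y).
  by clear -yz; lra.
have F0 y : 0 <= F y by apply: le_trans (fF y); exact: powR_ge0.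
pose h y := F y `^ q^-1 * \1_V y.
have qV0 : 0 <= q^-1 by rewrite invr_ge0 ltW.
have h0 y : 0 <= h y by rewrite mulr_ge0// powR_ge0.
have hG y : h y <= G1.
  apply: (@le_trans _ _ (F y `^ q^-1)).
    by apply: ler_piMr; [exact: powR_ge0|rewrite indicE; case: (_ \in _)].
  have -> : G1 = (G1 `^ q) `^ q^-1.
    by rewrite -powRrM mulfV ?gt_eqF// powRr1// ltW.
  by apply: ge0_ler_powR; rewrite ?nnegrE ?powR_ge0.
have hlsc : lower_semicontinuous (EFin \o h).
  apply: lower_semicontinuous_near => y; case: (pselect (V y)) => [Vy|nVy].
    have Vn : \forall z \near y, V z by exact: open_nbhs_nbhs.
    apply: filterS2 (Fnear y) Vn => z Fyz Vz; rewrite /h !indicE !mem_set// !mulr1.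
    by apply: ge0_ler_powR; rewrite ?nnegrE.
  apply: nearW => z; have -> : h y = 0 by rewrite /h indicE memNset// mulr0.
  exact: h0.
have bh : borel_fun (EFin \o h) by exact: lower_semicontinuous_borel.
have hmax : (maximal mu Omega q w kappa (EFin \o h) x <= tau%:E)%E.
  apply/(sup_average_le w0) => //; first exact: ltW.
    by move=> r /andP[r1 rk]; apply: Wfin => //; rewrite r1 ltW.
  move=> r /andP[r1 rk].
  have W0 : (0 <= W (ball x r))%E by exact: integral_ge0.
  have tq0 : 0 <= tau `^ q by exact: powR_ge0.
  have [rr0|r0r] := leP r r0.
    apply: (@le_trans _ _ 0%E); last by rewrite mule_ge0// lee_fin.
    rewrite /wint integral0_eq// => y; rewrite ballEmdist /= => xy.
    rewrite wpowerE// /h indicE memNset; first by rewrite mulr0 powR0 ?gt_eqF// mul0e.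
    by rewrite /V /=; apply/negP; rewrite -leNgt; clear -xy rr0; lra.
  have BB : ball x r `<=` B.
    by apply: ball_subset; rewrite mdistxx add0r; exact: ltW.
  have r0B : ball x r0 `<=` ball x r.
    by apply: ball_subset; rewrite mdistxx add0r; exact: ltW.
  apply: (@le_trans _ _ (\int[mu]_(y in ball x r) ((F y)%:E * w y))%E).
    have mw : measurable_fun setT w by exact: borel_measurable_fun.
    apply: ge0_le_integral => //.
    - by move=> y _; exact: wpower_ge0.
    - by apply: measurable_funTS; exact: measurable_wpower.
    - apply: measurable_funTS; apply: emeasurable_funM => //.
      apply: borel_measurable_fun => //; apply: lower_semicontinuous_borel.
      exact: lower_semicontinuous_near Fnear.
    move=> y _; rewrite wpowerE//; apply: lee_wpmul2r => //; rewrite lee_fin /h.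
    rewrite indicE; case: (_ \in _); last by rewrite mulr0 powR0 ?gt_eqF.
    by rewrite mulr1 -powRrM mulVf ?gt_eqF// powRr1.
  apply: le_trans (Fint _ (mb _ _) BB) _.
  have -> : ((tau `^ q)%:E * W (ball x r) =
      (m `^ q)%:E * W (ball x r) + (tau `^ q - m `^ q)%:E * W (ball x r))%E.
    rewrite -ge0_muleDl ?lee_fin ?powR_ge0 ?subr_ge0 ?(ltW mtau)//.
    by rewrite -EFinD addrC subrK.
  apply: leeD.
    apply: le_trans (Hx r _); last by rewrite r1.
    rewrite /wint le_eqVlt; apply/orP; left; apply/eqP; apply: eq_integral => y _.
    by rewrite /wpower gE /= ger0_norm// poweR_EFin.
  rewrite EFinM; apply: lee_wpmul2l; first by rewrite lee_fin subr_ge0 ltW.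
  by rewrite -b0E; exact: wmeasure_subset.
have [c [L [lc Lc0 c0 cL hc]]] := paths h h0 (ex_intro _ G1 hG) hlsc x tau Ox tau0 hmax.
have [s [/andP[s0 sL] xs sout]] := last_exit_ex lc Lc0 (ltW r00).
have us : `|u x - u (c s)| <= e * L0.
  apply: le_trans (Hu _ _) _; rewrite -c0.
  apply: (@le_trans _ _ (L0 * mdist (c 0) (c s))).
    by apply: ler_wpM2r; [exact: mdist_ge0|rewrite /L0 (le_trans (ler_norm Lu))// lerDl].
  by rewrite mulrC; apply: ler_wpM2r; [exact: ltW|exact: le_trans r0e].
have uL : `|u (c s)| <= K * tau * rho x.
  rewrite -[u (c s)]subr0 -(u0 _ cL) -lee_fin.
  apply: le_trans (ugc _ _ _ (lip1_is_curve lc sL)) _.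
  apply: le_trans (lip1_line_integral lc sL bg g0) _.
  apply: le_trans hc.
  have mc (f' : X -> \bar R) : borel_fun f' ->
      measurable_fun setT (f' \o c : measurableTypeR R -> \bar R).
    exact: lip1_measurable.
  rewrite -integral_itv_obnd_cbnd; last by apply: measurable_funTS; exact: mc.
  apply: (@le_trans _ _ (\int[lebesgue_measure]_(t in `]s, L]) (h (c t))%:E)%E).
    apply: ge0_le_integral => //.
    - by apply: measurable_funTS; exact: mc.
    - by apply: measurable_funTS; exact: (mc (EFin \o h)).
    move=> t /=; rewrite in_itv/= => /andP[st tL]; rewrite gE lee_fin /h.
    rewrite indicE mem_set ?mulr1; last by rewrite /V /= -c0; exact: sout.
    have -> : fine (g (c t)) = f (c t) `^ q^-1.
      by rewrite /f -powRrM mulfV ?gt_eqF// powRr1.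
    by apply: ge0_ler_powR; rewrite ?nnegrE ?powR_ge0.
  apply: ge0_subset_integral => //.
  - by apply: measurable_funTS; exact: (mc (EFin \o h)).
  - by move=> t /=; rewrite lee_fin.
  - by move=> t /=; rewrite !in_itv/= => /andP[st ->]; rewrite (le_trans s0 (ltW st)).
have H1 : `|u x| <= `|u x - u (c s)| + `|u (c s)|.
  by rewrite -[X in `|X| <= _](subrK (u (c s))); exact: ler_normD.
have H2 : K * tau * rho x = K * rho x * m + e * (K * rho x) by rewrite /tau; ring.
by clear -H1 H2 us uL eE; lra.
Qed.

Unset Implicit Arguments.

Theorem theorem7p4 (R : realType) (d : measure_display)
    (X : metricMeasurableType R d) (mu : {measure set X -> \bar R})
    (CQC : R) (Omega : set X) (w : X -> \bar R) (p0 p : R)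
    (two_points : exists x y : X, x <> y)
    (mu_complete : measure_is_complete mu)
    (mu_borel_regular : borel_regular mu)
    (mu_doubling : doubling mu)
    (CQC_ge1 : 1 <= CQC)
    (X_quasiconvex : quasiconvex X CQC)
    (Omega_open : open Omega)
    (Omega_nonempty : Omega !=set0)
    (Omega_proper : Omega <> [set: X])
    (p0_ge1 : 1 <= p0)
    (p0_lt_p : p0 < p)
    (w_doubling : semilocally_doubling mu Omega w)
    (w_poincare : poincare_weight mu Omega CQC p0 w)
    (hardy : pointwise_hardy mu Omega p w) :
  exists q : R, p0 < q < p /\ pointwise_hardy mu Omega q w.
Proof.
have [borel_measurable _] := mu_borel_regular.
have [[bw w0 _ _] _] := w_poincare.
have Omega_proper' : ~` Omega !=set0.
  by apply/set0P; apply/eqP => /(congr1 setC); rewrite setCK setC0.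
have [q [kappa [K [pq k1 K0 Wfin paths]]]] :=
  hardy_path_self_improvement borel_measurable mu_doubling CQC_ge1 X_quasiconvex
    Omega_open Omega_proper' bw w0 p0_ge1 p0_lt_p w_doubling w_poincare hardy.
exists q; split => //; apply: (hardy_of_paths _ _ _ _ _ _ k1 K0 Wfin paths) => //.
by case/andP: pq => p0q _; lra.
Qed.
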